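(* There is an algorithm that, given a tree $T$ whose vertex set is a set $C$ of $m$ candidates and which has $k$ leaves, and a ranking $v\in\mathcal{L}(C)$, computes $\mathrm{swap}(\mathrm{SP}(T),v)$ in time $O(k m^k)$.
   Context: $\mathcal{L}(C)$ is the set of all linear orders (rankings, votes) over $C$. The swap distance $\mathrm{swap}(u,v)$ is the number of unordered pairs of candidates whose relative order differs in $u$ and $v$. For a set of rankings $D$, $\mathrm{swap}(D,v)=\min_{u\in D}\mathrm{swap}(u,v)$. For a connected undirected graph $G$ with vertex set $C$, a ranking is single-peaked with respect to $G$ if for every $t\in\{1,\dots,m\}$ the subgraph of $G$ induced by its $t$ top-ranked candidates is connected; $\mathrm{SP}(G)\subseteq\mathcal{L}(C)$ is the set of all such rankings. A leaf of $T$ is a vertex of degree $1$. *)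

(* Defs.v *)
From mathcomp Require Import all_boot all_fingroup.

Set Implicit Arguments.
Unset Strict Implicit.
Unset Printing Implicit Defensive.

(** * Trees *)

(* A simple graph on the candidates 'I_m is a symmetric irreflexive relation. *)
Definition simple_graph m (e : rel 'I_m) : Prop := symmetric e /\ irreflexive e.

Definition induced_connected m (e : rel 'I_m) (S : {set 'I_m}) : bool :=
  (S != set0) &&
  [forall x in S, forall y in S,
     connect [rel a b | [&& a \in S, b \in S & e a b]] x y].

(* In a symmetric relation, [:: x; y] is a [cycle] as soon as x and y are
   adjacent; graph cycles are the simple ones with at least three vertices. *)
Definition acyclic m (e : rel 'I_m) : Prop :=
  forall s : seq 'I_m, 2 < size s -> ~~ ucycleb e s.

Definition is_tree m (e : rel 'I_m) : Prop :=
  [/\ simple_graph e, induced_connected e [set: 'I_m] & acyclic e].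

Definition degree m (e : rel 'I_m) (x : 'I_m) : nat := #|[set y | e x y]|.

Definition num_leaves m (e : rel 'I_m) : nat := #|[set x | degree e x == 1]|.

(** * Rankings *)

(* A ranking v maps each candidate to its position; position 0 is the top. *)
Definition ranking (m : nat) := {perm 'I_m}.

Definition prefers m (v : ranking m) (a b : 'I_m) : bool := v a < v b.

(* Each unordered pair of candidates is represented by (a, b) with a < b. *)
Definition swap m (u v : ranking m) : nat :=
  #|[set p : 'I_m * 'I_m |
      (p.1 < p.2) && (prefers u p.1 p.2 != prefers v p.1 p.2)]|.

(* [d] is the minimum of [swap u v] over [u \in D]; there is none when D is
   empty. *)
Definition is_swap_set m (D : {set ranking m}) (v : ranking m) (d : nat) : Prop :=
  (exists2 u, u \in D & swap u v = d) /\ (forall u, u \in D -> d <= swap u v).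

Definition top_ranked m (v : ranking m) (t : nat) : {set 'I_m} :=
  [set c | v c < t].

(* t : 'I_m is shifted by one, so that t.+1 ranges over 1, ..., m. *)
Definition SP m (e : rel 'I_m) : {set ranking m} :=
  [set v : ranking m | [forall t : 'I_m, induced_connected e (top_ranked v t.+1)]].

(** * Algorithms: unit-cost RAM programs *)

(* The machine has registers and an indirectly addressed memory, both holding
   natural numbers.  The only arithmetic is addition and truncated subtraction:
   with multiplication, unit cost would not be a realistic measure of time. *)
Record state := State { reg : nat -> nat; mem : nat -> nat }.

Definition update (f : nat -> nat) (a x : nat) : nat -> nat :=
  fun b => if b == a then x else f b.

Definition set_reg (s : state) (r x : nat) := State (update (reg s) r x) (mem s).
Definition set_mem (s : state) (a x : nat) := State (reg s) (update (mem s) a x).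

Inductive cmd : Type :=
| Skip
| Const (r n : nat)       (* reg r := n *)
| Add (r r1 r2 : nat)     (* reg r := reg r1 + reg r2 *)
| Sub (r r1 r2 : nat)     (* reg r := reg r1 - reg r2 *)
| Read (r r1 : nat)       (* reg r := mem (reg r1) *)
| Write (r1 r : nat)      (* mem (reg r1) := reg r *)
| Seq (p q : cmd)
| If (r : nat) (p q : cmd)  (* tests reg r <> 0 *)
| While (r : nat) (p : cmd).

(* [exec p s t s']: from state s, program p halts in state s' after t steps.
   Every instruction and every test of a conditional or a loop is one step. *)
Inductive exec : cmd -> state -> nat -> state -> Prop :=
| exec_skip s : exec Skip s 1 s
| exec_const s r n : exec (Const r n) s 1 (set_reg s r n)
| exec_add s r r1 r2 :
    exec (Add r r1 r2) s 1 (set_reg s r (reg s r1 + reg s r2))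
| exec_sub s r r1 r2 :
    exec (Sub r r1 r2) s 1 (set_reg s r (reg s r1 - reg s r2))
| exec_read s r r1 : exec (Read r r1) s 1 (set_reg s r (mem s (reg s r1)))
| exec_write s r1 r : exec (Write r1 r) s 1 (set_mem s (reg s r1) (reg s r))
| exec_seq p q s t s1 t' s2 :
    exec p s t s1 -> exec q s1 t' s2 -> exec (Seq p q) s (t + t') s2
| exec_if_true r p q s t s1 :
    reg s r != 0 -> exec p s t s1 -> exec (If r p q) s t.+1 s1
| exec_if_false r p q s t s1 :
    reg s r = 0 -> exec q s t s1 -> exec (If r p q) s t.+1 s1
| exec_while_true r p s t s1 t' s2 :
    reg s r != 0 -> exec p s t s1 -> exec (While r p) s1 t' s2 ->
    exec (While r p) s (t + t').+1 s2
| exec_while_false r p s : reg s r = 0 -> exec (While r p) s 1 s.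

(* The adjacency matrix, row by row, then the candidates from top to bottom. *)
Definition input_words m (e : rel 'I_m) (v : ranking m) : seq nat :=
  [seq nat_of_bool (e i j) | i <- enum 'I_m, j <- enum 'I_m] ++
  [seq nat_of_ord ((v^-1)%g t) | t <- enum 'I_m].

(* The number of leaves is not part of the input. *)
Definition input m (e : rel 'I_m) (v : ranking m) : state :=
  State (update (fun=> 0) 0 m) (nth 0 (input_words e v)).

Definition output (s : state) : nat := reg s 0.

(* Main.v *)
Require Import Defs.
From mathcomp Require Import all_boot all_fingroup.
From mathcomp Require Import zify.

Set Implicit Arguments.
Unset Strict Implicit.
Unset Printing Implicit Defensive.

(* Build the rankings of SP(T) from the bottom: the candidate at the bottom of a
   connected set S must be a leaf x of the subtree S, and then costs the number
   of elements of S that v puts below x.  Hence the optimum f(S) is the minimum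
   over the leaves x of S of f(S - x) + c(S - x, x); and c(S - x, x) follows in
   constant time from c(S - {x, y}, x), where y is another leaf of S.

   The tree is rooted at one of its leaves and its vertices are numbered in
   preorder, so that the subtree below i is an interval [i, skip i).  For each
   top a, in decreasing order, the connected sets with top a are the outcomes of
   binary decisions: exclude i and go on with skip i, or include i and go on
   with i + 1.  Deciding to exclude first makes every set come after its subsets.
   The number of outcomes is at most m ^ l, where l = k - 1 is the number of
   leaves other than the root, and each set has at most k leaves, which gives
   O(k m^k) over the m tops.

   Time is counted in a language with expressions and unbounded arrays, whose
   compilation to the RAM costs a constant factor. *)

(** * A programming language *)

(** The bound leaves no slack: a factor $m$ goes to the tops and $m^{k-1}$ to the sets, so one set
    may cost only $O(k)$ steps although it can have $m$ elements. Hence nothing about a set is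
    recomputed. Its list of leaves, its table address and the number of children of its top are
    updated in constant time whenever an element is included or taken back. Preorder makes this
    possible: elements enter and leave only at the end of the set, where at most one old leaf, the
    previous last element, stops being a leaf.

    The shortcut for $c$ needs $S \setminus \{x, y\}$ to be connected; it is the intersection of the
    subtrees $S \setminus \{x\}$ and $S \setminus \{y\}$. Removing the top of a set yields a set
    with a larger top, which dictates the decreasing order of the tops.

    The table needs no search structure: the address of $S$ is built from its binary code by
    additions alone. Such addresses are exponential in $m$, but only the cells that are accessed
    cost time.

    Choosing a leaf as root is what saves a factor $m$: the root is one of the $k$ leaves, yet it
    does not count in the exponent. *)

Inductive expr : Type :=
| ECst (n : nat)
| EVar (x : nat)
| EAdd (a b : expr)
| ESub (a b : expr)
| EArr (id : nat) (a : expr)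
| EInp (a : expr).

Inductive prog : Type :=
| PNop
| PSet (x : nat) (a : expr)
| PPut (id : nat) (a b : expr)
| PSeq (p q : prog)
| PIf (a : expr) (p q : prog)
| PWhile (a : expr) (p : prog).

Record env := Env { var : nat -> nat; arr : nat -> nat -> nat }.

Section Semantics.

Variable inp : nat -> nat.

Fixpoint eval (h : env) (a : expr) : nat :=
  match a with
  | ECst n => n
  | EVar x => var h x
  | EAdd a b => eval h a + eval h b
  | ESub a b => eval h a - eval h b
  | EArr id a => arr h id (eval h a)
  | EInp a => inp (eval h a)
  end.

Definition set_var (h : env) x n := Env (update (var h) x n) (arr h).

Definition set_arr (h : env) id i n :=
  Env (var h) (fun id' => if id' == id then update (arr h id) i n else arr h id').

Inductive hexec : prog -> env -> nat -> env -> Prop :=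
| hexec_nop h : hexec PNop h 1 h
| hexec_set h x a : hexec (PSet x a) h 1 (set_var h x (eval h a))
| hexec_put h id a b : hexec (PPut id a b) h 1 (set_arr h id (eval h a) (eval h b))
| hexec_seq p q h t h1 t' h2 :
    hexec p h t h1 -> hexec q h1 t' h2 -> hexec (PSeq p q) h (t + t') h2
| hexec_if_true a p q h t h1 :
    eval h a != 0 -> hexec p h t h1 -> hexec (PIf a p q) h t.+1 h1
| hexec_if_false a p q h t h1 :
    eval h a = 0 -> hexec q h t h1 -> hexec (PIf a p q) h t.+1 h1
| hexec_while_true a p h t h1 t' h2 :
    eval h a != 0 -> hexec p h t h1 -> hexec (PWhile a p) h1 t' h2 ->
    hexec (PWhile a p) h (t + t').+1 h2
| hexec_while_false a p h : eval h a = 0 -> hexec (PWhile a p) h 1 h.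

(** * Total correctness with step bounds *)

Definition runs p h T (Q : env -> Prop) :=
  exists t h', [/\ hexec p h t h', t <= T & Q h'].

Fixpoint loop_free p :=
  match p with
  | PSeq p q | PIf _ p q => loop_free p && loop_free q
  | PWhile _ _ => false
  | _ => true
  end.

Fixpoint run p h :=
  match p with
  | PNop | PWhile _ _ => h
  | PSet x a => set_var h x (eval h a)
  | PPut id a b => set_arr h id (eval h a) (eval h b)
  | PSeq p q => run q (run p h)
  | PIf a p q => if eval h a == 0 then run q h else run p h
  end.

Fixpoint psize p :=
  match p with
  | PSeq p q | PIf _ p q => (psize p + psize q).+1
  | _ => 1
  end.

Lemma runs_run p h T (Q : env -> Prop) :
  loop_free p -> psize p <= T -> Q (run p h) -> runs p h T Q.
Proof.
suff H : loop_free p -> exists2 t, hexec p h t (run p h) & t <= psize p.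
  by move=> /H[t ht tp] pT Qh; exists t, (run p h); split=> //; apply: leq_trans pT.
elim: p h {T Q} => [|x a|id a b|p IHp q IHq|a p IHp q IHq|//] h /=.
- by exists 1 => //; constructor.
- by exists 1 => //; constructor.
- by exists 1 => //; constructor.
- case/andP=> /(IHp h)[t pt tp] /(IHq (run p h))[t' qt tq].
  by exists (t + t'); [econstructor; eauto|lia].
- case/andP=> /(IHp h)[t pt tp] /(IHq h)[t' qt tq]; case: eqP => [a0|/eqP a0].
    by exists t'.+1; [apply: hexec_if_false|lia].
  by exists t.+1; [apply: hexec_if_true|lia].
Qed.

Lemma runs_weaken p h T T' (Q Q' : env -> Prop) :
  runs p h T Q -> T <= T' -> (forall h', Q h' -> Q' h') -> runs p h T' Q'.
Proof.
by case=> t [h' [ht tT Qh]] TT' QQ'; exists t, h'; split; [|lia|exact: QQ'].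
Qed.

Lemma runs_le p h T T' Q : runs p h T Q -> T <= T' -> runs p h T' Q.
Proof. by move=> r l; apply: runs_weaken r l _. Qed.

Lemma runs_seq p q h T1 T2 Q1 Q2 :
  runs p h T1 Q1 -> (forall h', Q1 h' -> runs q h' T2 Q2) ->
  runs (PSeq p q) h (T1 + T2) Q2.
Proof.
case=> t1 [h1 [ht1 le1 Qh1]] /(_ _ Qh1)[t2 [h2 [ht2 le2 Qh2]]].
by exists (t1 + t2), h2; split; [econstructor; eauto|lia|].
Qed.

Lemma runs_seq_run p q h T (Q : env -> Prop) :
  loop_free p -> runs q (run p h) T Q -> runs (PSeq p q) h (psize p + T) Q.
Proof.
by move=> lf Hq; apply: (@runs_seq _ _ _ _ _ (eq (run p h))) => [|h' <-//]; apply: runs_run.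
Qed.

Lemma runs_if a p q h T (Q : env -> Prop) :
  (eval h a != 0 -> runs p h T Q) -> (eval h a = 0 -> runs q h T Q) ->
  runs (PIf a p q) h T.+1 Q.
Proof.
case: (eqVneq (eval h a) 0) => a0.
  move=> _ /(_ a0)[t [h' [ht tT Qh]]].
  by exists t.+1, h'; split=> //; apply: hexec_if_false.
move=> /(_ isT)[t [h' [ht tT Qh]]] _.
by exists t.+1, h'; split=> //; apply: hexec_if_true.
Qed.

Lemma runs_while_false a p h (Q : env -> Prop) :
  eval h a = 0 -> Q h -> runs (PWhile a p) h 1 Q.
Proof. by move=> a0 Qh; exists 1, h; split=> //; apply: hexec_while_false. Qed.

Lemma runs_while_true a p h T T' Q Q' :
  eval h a != 0 -> runs p h T Q ->
  (forall h', Q h' -> runs (PWhile a p) h' T' Q') ->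
  runs (PWhile a p) h (T + T').+1 Q'.
Proof.
move=> a0 [t [h1 [ht tT Qh]]] /(_ _ Qh)[t' [h2 [ht' tT' Qh']]].
by exists (t + t').+1, h2; split=> //; [econstructor; eauto|lia].
Qed.

(** Each of the at most [n] iterations pays [C] for the body and one step for the test; the outer
    successor pays for the test that fails. *)
Lemma runs_while a p (I : env -> Prop) (mu : env -> nat) C h n :
  (forall h, I h -> eval h a != 0 ->
     runs p h C (fun h' => I h' /\ mu h' < mu h)) ->
  I h -> mu h <= n ->
  runs (PWhile a p) h (n * C.+1).+1 (fun h' => I h' /\ eval h' a = 0).
Proof.
move=> body; elim: n h => [|n IHn] h Ih mun; case: (eqVneq (eval h a) 0) => a0.
- exact: runs_while_false.
- by have [t [h' [_ _ [_ lt]]]] := body _ Ih a0; lia.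
- apply: (@runs_weaken _ _ 1 _ (fun h' => I h' /\ eval h' a = 0)) => //.
  exact: runs_while_false.
- rewrite (_ : (n.+1 * C.+1).+1 = (C + (n * C.+1).+1).+1); last by lia.
  apply: runs_while_true a0 (body _ Ih a0) _ => h' [Ih' lt].
  by apply: IHn => //; lia.
Qed.

(* Partial executions of a loop, in continuation-passing style so that they
   compose. *)
Definition reach a p h T (Q : env -> Prop) :=
  forall T' R, (forall h', Q h' -> runs (PWhile a p) h' T' R) ->
  runs (PWhile a p) h (T + T') R.

Lemma reach_step a p h C Q : eval h a != 0 -> runs p h C Q -> reach a p h C.+1 Q.
Proof. by move=> a0 r T' R H; apply: runs_while_true a0 r H. Qed.

Lemma reach_trans a p h T1 T2 Q1 Q2 :
  reach a p h T1 Q1 -> (forall h', Q1 h' -> reach a p h' T2 Q2) ->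
  reach a p h (T1 + T2) Q2.
Proof.
by move=> r1 r2 T R H; rewrite -addnA; apply: r1 => h' Qh; apply: r2 Qh _ _ H.
Qed.

Lemma reach_weaken a p h T T' (Q Q' : env -> Prop) :
  reach a p h T Q -> T <= T' -> (forall h', Q h' -> Q' h') -> reach a p h T' Q'.
Proof.
move=> r TT' QQ' T2 R H; apply: (@runs_le _ _ (T + T2)); last by rewrite leq_add2r.
by apply: r => h' /QQ'; apply: H.
Qed.

End Semantics.

(* Variables live in the even registers, temporaries in the odd ones from 3 on,
   and register 1 holds the first free address, where the 16 arrays start,
   interleaved. *)
Definition tmp d := d.*2.+3.

(** Four doublings multiply the index by 16, as the machine cannot multiply. *)
Definition comp_addr id d : cmd :=
  let r := tmp d in
  Seq (Add r r r) (Seq (Add r r r) (Seq (Add r r r) (Seq (Add r r r)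
    (Seq (Add r r 1) (Seq (Const (tmp d.+1) id) (Add r r (tmp d.+1))))))).

(** [d] is the nesting depth: values already computed sit in temporaries below [tmp d], which stay
    untouched. Since the arrays begin right behind the input, an input address beyond it is cut off
    and read as 0. *)
Fixpoint comp_expr (a : expr) (d : nat) : cmd :=
  let r := tmp d in
  match a with
  | ECst n => Const r n
  | EVar x => Seq (Const r 0) (Add r r x.*2)
  | EAdd a b => Seq (comp_expr a d) (Seq (comp_expr b d.+1) (Add r r (tmp d.+1)))
  | ESub a b => Seq (comp_expr a d) (Seq (comp_expr b d.+1) (Defs.Sub r r (tmp d.+1)))
  | EArr id a => Seq (comp_expr a d) (Seq (comp_addr id d) (Read r r))
  | EInp a => Seq (comp_expr a d)
      (Seq (Defs.Sub (tmp d.+1) 1 r) (If (tmp d.+1) (Read r r) (Const r 0)))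
  end.

Fixpoint texpr (a : expr) : nat :=
  match a with
  | ECst n => 1
  | EVar x => 2
  | EAdd a b | ESub a b => texpr a + (texpr b + 1)
  | EArr id a => texpr a + 8
  | EInp a => texpr a + 3
  end.

(** [While] tests a register only, so the guard is evaluated once before the loop and again at the
    end of each body. Variable 0 is register 0, which carries both the input [m] and the output. *)
Fixpoint comp (p : prog) : cmd :=
  match p with
  | PNop => Skip
  | PSet x a => Seq (comp_expr a 0) (Seq (Const 5 0) (Add x.*2 3 5))
  | PPut id a b =>
      Seq (comp_expr a 0) (Seq (comp_addr id 0) (Seq (comp_expr b 1) (Write 3 5)))
  | PSeq p q => Seq (comp p) (comp q)
  | PIf a p q => Seq (comp_expr a 0) (If 3 (comp p) (comp q))
  | PWhile a p => Seq (comp_expr a 0) (While 3 (Seq (comp p) (comp_expr a 0)))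
  end.

(** Adding up the costs over the whole program text bounds the cost of any single step, whatever the
    state and the branch taken. *)
Fixpoint slowdown (p : prog) : nat :=
  match p with
  | PNop => 1
  | PSet x a => texpr a + 2
  | PPut id a b => texpr a + texpr b + 8
  | PSeq p q => slowdown p + slowdown q
  | PIf a p q => texpr a + 1 + slowdown p + slowdown q
  | PWhile a p => texpr a + 1 + slowdown p
  end.

Fixpoint wf_expr a :=
  match a with
  | ECst _ | EVar _ => true
  | EAdd a b | ESub a b => wf_expr a && wf_expr b
  | EArr id a => (id < 16) && wf_expr a
  | EInp a => wf_expr a
  end.

Fixpoint wf p :=
  match p with
  | PNop => true
  | PSet x a => wf_expr a
  | PPut id a b => [&& id < 16, wf_expr a & wf_expr b]
  | PSeq p q => wf p && wf q
  | PIf a p q => [&& wf_expr a, wf p & wf q]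
  | PWhile a p => wf_expr a && wf p
  end.

(** * Simulation of the language on the RAM *)

Section Compiler.

Variables (inp : nat -> nat) (base : nat).
Hypothesis inp0 : forall i, base <= i -> inp i = 0.

Definition represents (s : state) (h : env) : Prop :=
  [/\ forall x, reg s x.*2 = var h x, reg s 1 = base,
      forall i, i < base -> Defs.mem s i = inp i
    & forall id i, id < 16 -> Defs.mem s (base + i * 16 + id) = arr h id i].

Definition frame d (s s' : state) : Prop :=
  Defs.mem s' = Defs.mem s /\ forall r, ~~ odd r || (r < tmp d) -> reg s' r = reg s r.

Lemma frame_represents d s s' h : frame d s s' -> represents s h -> represents s' h.
Proof.
case=> Em Er [Hv Hb Hi Ha]; split; rewrite ?Em //; first move=> x.
  by rewrite Er ?odd_double.
by rewrite Er ?Hb // /tmp.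
Qed.

Lemma frame_trans d s1 s2 s3 : frame d s1 s2 -> frame d s2 s3 -> frame d s1 s3.
Proof.
case=> m1 r1 [m2 r2]; split=> [|r Hr]; first by rewrite m2.
by rewrite r2 // r1.
Qed.

Lemma frameS d s1 s2 : frame d.+1 s1 s2 -> frame d s1 s2.
Proof.
by case=> m1 r1; split=> // r Hr; apply: r1; rewrite /tmp in Hr *; lia.
Qed.

Lemma frame_set_tmp d d' s n : d <= d' -> frame d s (set_reg s (tmp d') n).
Proof.
move=> dd'; split=> // r Hr; rewrite /= /update; case: eqP => // E.
by move: Hr; rewrite E /tmp /= odd_double /=; lia.
Qed.

Lemma tmp_eq d d' : (tmp d == tmp d') = (d == d').
Proof. by rewrite /tmp; lia. Qed.

Lemma exec_addr id d s : reg s 1 = base ->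
  exists s', [/\ exec (comp_addr id d) s 7 s', frame d s s'
    & reg s' (tmp d) = base + reg s (tmp d) * 16 + id].
Proof.
move=> Hb; eexists; split.
- rewrite -[7]/(1 + (1 + (1 + (1 + (1 + (1 + 1)))))).
  by do 6 (apply: exec_seq; first by constructor); constructor.
- by do 6 (apply: frame_trans; last by apply: frame_set_tmp); apply: frame_set_tmp.
- rewrite /= /update !eqxx !tmp_eq (ltn_eqF (ltnSn d)) /= Hb; lia.
Qed.

Lemma exec_expr a d s h : wf_expr a -> represents s h ->
  exists s', [/\ exec (comp_expr a d) s (texpr a) s', frame d s s'
    & reg s' (tmp d) = eval inp h a].
Proof.
elim: a d s => [n|x|a IHa b IHb|a IHa b IHb|id a IHa|a IHa] d s /=.
- move=> _ _; eexists; split; [by constructor|exact: frame_set_tmp|].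
  by rewrite /= /update eqxx.
- move=> _ [Hv _ _ _]; eexists; split.
  + by apply: (@exec_seq _ _ _ 1 _ 1); constructor.
  + by apply: frame_trans; apply: frame_set_tmp.
  + by rewrite /= /update !eqxx; case: eqP => [|_]; rewrite ?Hv // /tmp; lia.
- case/andP=> wa wb rs; have [s1 [x1 f1 e1]] := IHa d s wa rs.
  have [s2 [x2 f2 e2]] := IHb d.+1 s1 wb (frame_represents f1 rs).
  eexists; split.
  + by apply: exec_seq x1 _; apply: exec_seq x2 _; constructor.
  + apply: frame_trans f1 _; apply: frame_trans (frameS f2) _.
    exact: frame_set_tmp.
  + by rewrite /= /update eqxx e2 (proj2 f2) ?e1 // /tmp; lia.
- case/andP=> wa wb rs; have [s1 [x1 f1 e1]] := IHa d s wa rs.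
  have [s2 [x2 f2 e2]] := IHb d.+1 s1 wb (frame_represents f1 rs).
  eexists; split.
  + by apply: exec_seq x1 _; apply: exec_seq x2 _; constructor.
  + apply: frame_trans f1 _; apply: frame_trans (frameS f2) _.
    exact: frame_set_tmp.
  + by rewrite /= /update eqxx e2 (proj2 f2) ?e1 // /tmp; lia.
- case/andP=> lid wa rs; have [s1 [x1 f1 e1]] := IHa d s wa rs.
  have rs1 := frame_represents f1 rs; have [_ b1 _ _] := rs1.
  have [s2 [x2 f2 e2]] := exec_addr id d b1.
  have [_ _ _ ha] := frame_represents f2 rs1.
  eexists; split.
  + by apply: exec_seq x1 _; apply: (@exec_seq _ _ _ 7 _ 1); [exact: x2|constructor].
  + by apply: frame_trans f1 _; apply: frame_trans f2 _; apply: frame_set_tmp.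
  + by rewrite /= /update eqxx e2 ha // e1.
- move=> wa rs; have [s1 [x1 f1 e1]] := IHa d s wa rs.
  have [_ b1 hi _] := frame_represents f1 rs.
  have E : (tmp d == tmp d.+1) = false by rewrite tmp_eq; lia.
  case: (ltnP (eval inp h a) base) => cmp.
  + eexists; split.
    * apply: exec_seq x1 _; apply: (@exec_seq _ _ _ 1 _ 2); first by constructor.
      by apply: exec_if_true; [rewrite /= /update eqxx b1 e1; lia|constructor].
    * apply: frame_trans f1 _; apply: frame_trans; last exact: frame_set_tmp.
      exact: frame_set_tmp.
    * by rewrite /= /update eqxx E e1 hi.
  + eexists; split.
    * apply: exec_seq x1 _; apply: (@exec_seq _ _ _ 1 _ 2); first by constructor.
      by apply: exec_if_false; [rewrite /= /update eqxx b1 e1; lia|constructor].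
    * apply: frame_trans f1 _; apply: frame_trans; last exact: frame_set_tmp.
      exact: frame_set_tmp.
    * by rewrite /= /update eqxx inp0.
Qed.

Lemma exec_comp p h t h' : hexec inp p h t h' -> wf p -> forall s, represents s h ->
  exists t' s', [/\ exec (comp p) s t' s', t' <= slowdown p * t & represents s' h'].
Proof.
elim=> {p h t h'}.
- by move=> h _ s rs; exists 1, s; split=> //; constructor.
- move=> h x a /= wa s rs; have [s1 [x1 f1 e1]] := exec_expr 0 wa rs.
  have [hv hb hi ha] := frame_represents f1 rs.
  eexists; eexists; split.
  + by apply: exec_seq x1 _; apply: (@exec_seq _ _ _ 1 _ 1); constructor.
  + lia.
  + split=> [y||//|//] /=; rewrite /update.
    * rewrite (_ : (y.*2 == x.*2) = (y == x)); last by lia.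
      case: (y =P x) => [_|_]; first by rewrite /= (e1 : reg s1 3 = _) addn0.
      by case: eqP => // E; lia.
    * by rewrite (_ : (1 == x.*2) = false) //; lia.
- move=> h id a b /= /and3P[lid wa wb] s rs.
  have [s1 [x1 f1 e1]] := exec_expr 0 wa rs; have r1 := frame_represents f1 rs.
  have [_ b1 _ _] := r1.
  have [s2 [x2 f2 e2]] := exec_addr id 0 b1; have r2 := frame_represents f2 r1.
  have [s3 [x3 f3 e3]] := exec_expr 1 wb r2.
  have [hv hb hi ha] := frame_represents f3 r2.
  eexists; eexists; split.
  + by apply: exec_seq x1 _; apply: exec_seq x2 _; apply: exec_seq x3 _; constructor.
  + lia.
  + have E3 : reg s3 3 = base + eval inp h a * 16 + id.
      by rewrite (proj2 f3) //; rewrite /= in e1 e2; rewrite e2 e1.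
    split=> [//|//|i li|id' i lid'] /=; rewrite /update E3.
    * by case: eqP => [E|_]; [lia|exact: hi].
    * case: eqP => E.
        by rewrite (_ : id' = id); [rewrite eqxx (_ : i = eval inp h a) ?eqxx //; lia|lia].
      by case: eqP => [Ei|_]; [case: eqP => Ei'; [lia|rewrite ha // Ei]|rewrite ha].
- move=> p q h t h1 t' h2 _ IHp _ IHq /= /andP[wp wq] s rs.
  have [t1 [s1 [x1 l1 r1]]] := IHp wp s rs.
  have [t2 [s2 [x2 l2 r2]]] := IHq wq s1 r1.
  exists (t1 + t2), s2; split=> //; first by apply: exec_seq x2.
  rewrite mulnDl !mulnDr; lia.
- move=> a p q h t h1 a0 _ IHp /= /and3P[wa wp wq] s rs.
  have [s1 [x1 f1 e1]] := exec_expr 0 wa rs; have r1 := frame_represents f1 rs.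
  have [t2 [s2 [x2 l2 r2]]] := IHp wp s1 r1.
  eexists; exists s2; split; last by [].
    by apply: exec_seq x1 _; apply: exec_if_true x2; rewrite (e1 : reg s1 3 = _).
  rewrite !mulnDl !mulnS; lia.
- move=> a p q h t h1 a0 _ IHp /= /and3P[wa wp wq] s rs.
  have [s1 [x1 f1 e1]] := exec_expr 0 wa rs; have r1 := frame_represents f1 rs.
  have [t2 [s2 [x2 l2 r2]]] := IHp wq s1 r1.
  eexists; exists s2; split; last by [].
    by apply: exec_seq x1 _; apply: exec_if_false x2; rewrite (e1 : reg s1 3 = _).
  rewrite !mulnDl !mulnS; lia.
- move=> a p h t h1 t' h2 a0 _ IHp _ IHw /= w s rs; have /andP[wa wp] := w.
  have [s1 [x1 f1 e1]] := exec_expr 0 wa rs; have r1 := frame_represents f1 rs.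
  have [t2 [s2 [x2 l2 r2]]] := IHp wp s1 r1.
  have [t3 [s3 [x3 l3 r3]]] := IHw w s2 r2.
  (* The induction hypothesis runs the rest of the loop preceded by an evaluation of the guard.
     Inversion detaches this evaluation, which becomes the end of the body just executed. *)
  inversion x3 as [| | | | | |p' q' s' t4 s4 t5 s5 x4 x5 E1 E2 E3 E4| | | |]; subst.
  eexists; exists s3; split; last by [].
    apply: exec_seq x1 _; apply: exec_while_true; first by rewrite (e1 : reg s1 3 = _).
      by apply: exec_seq x2 x4.
    exact: x5.
  move: l2 l3; rewrite /= !mulnDl !mulnS !mulnDr; lia.
- move=> a p h a0 /= /andP[wa wp] s rs.
  have [s1 [x1 f1 e1]] := exec_expr 0 wa rs; have r1 := frame_represents f1 rs.
  eexists; exists s1; split; last by [].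
    by apply: exec_seq x1 _; apply: exec_while_false; rewrite (e1 : reg s1 3 = _).
  lia.
Qed.

End Compiler.

(* Register 1 is set to m * m + m, the length of the input. *)
Definition prologue : cmd :=
  Seq (Const 3 0) (Seq (Add 3 3 0) (Seq (Const 5 1)
    (Seq (While 3 (Seq (Add 1 1 0) (Defs.Sub 3 3 5))) (Add 1 1 0)))).

Lemma exec_prologue m (e : rel 'I_m) (v : ranking m) :
  exists t s, [/\ exec prologue (input e v) t s, t <= 3 * m + 5
    & represents (nth 0 (input_words e v)) (m * m + m) s
        (Env (update (fun=> 0) 0 m) (fun _ _ => 0))].
Proof.
have loop n s : reg s 3 = n -> reg s 5 = 1 -> reg s 0 = m ->
  exists s', [/\ exec (While 3 (Seq (Add 1 1 0) (Defs.Sub 3 3 5))) s (3 * n).+1 s',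
    reg s' 1 = reg s 1 + n * m, Defs.mem s' = Defs.mem s
    & forall x, reg s' x.*2 = reg s x.*2].
  elim: n s => [|n IHn] s s3 s5 s0.
    by exists s; split=> //; [apply: exec_while_false|lia].
  set s1 := set_reg (set_reg s 1 (reg s 1 + m)) 3 n.
  have [|||s' [x' e' m' r']] := IHn s1 => //; exists s'; split.
  - rewrite (_ : (3 * n.+1).+1 = (1 + 1 + (3 * n).+1).+1); last by lia.
    apply: exec_while_true x'; first by rewrite s3.
    apply: (@exec_seq _ _ _ _ (set_reg s 1 (reg s 1 + m))).
      by rewrite -[X in _ + X]s0; constructor.
    rewrite /s1; set s2 := set_reg s 1 _.
    by rewrite (_ : n = reg s2 3 - reg s2 5); [constructor|rewrite /= /update /= s3 s5; lia].
  - by rewrite e' /= /update /= mulSn addnA.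
  - by rewrite m'.
  - by move=> x; rewrite r' /= /update; do 2 (case: eqP => [?|_]; first by lia).
set s1 := set_reg (set_reg (set_reg (input e v) 3 0) 3 m) 5 1.
have [|||s' [x' e' m' r']] := loop m s1 => //.
exists (1 + (1 + (1 + ((3 * m).+1 + 1)))), (set_reg s' 1 (m * m + m)); split.
- apply: exec_seq; first by constructor.
  apply: exec_seq; first by constructor.
  apply: exec_seq; first by constructor.
  apply: exec_seq; first exact: x'.
  rewrite (_ : m * m + m = reg s' 1 + reg s' 0); first by constructor.
  by rewrite e' (r' 0).
- lia.
- have sz : size (input_words e v) = m * m + m.
    by rewrite size_cat size_allpairs size_map size_enum_ord.
  split=> [x|//|i _|id i _].
  + rewrite /= /update; case: eqP => [?|_]; first by lia.
    rewrite r' /= /update; case: eqP => [?|_]; first by lia.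
    by case: eqP => [?|_]; [lia|rewrite (_ : (x.*2 == 0) = (x == 0)) //; lia].
  + by rewrite /= m'.
  + by rewrite /= m' /= nth_default // sz; lia.
Qed.

(** * The program *)

Local Notation "p ;; q" := (PSeq p q) (at level 70, right associativity).
Local Notation "x ::= a" := (PSet x a) (at level 60).
Local Notation "a +' b" := (EAdd a b) (at level 50, left associativity).
Local Notation "a -' b" := (ESub a b) (at level 50, left associativity).
Local Notation "$ x" := (EVar x) (at level 1, format "$ x").
Local Notation "# n" := (ECst n) (at level 1, format "# n").
Local Notation "t @[ a ]" := (EArr t a) (at level 1, format "t @[ a ]").

Local Notation vm := 0 (only parsing).
Local Notation vi := 1 (only parsing).
Local Notation vacc := 2 (only parsing).
Local Notation vj := 3 (only parsing).
Local Notation vdeg := 4 (only parsing).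
Local Notation vroot := 5 (only parsing).
Local Notation vcnt := 6 (only parsing).
Local Notation vu := 7 (only parsing).
Local Notation vrun := 8 (only parsing).
Local Notation vw := 9 (only parsing).
Local Notation vwt := 10 (only parsing).
Local Notation va := 11 (only parsing).
Local Notation vend := 12 (only parsing).
Local Notation vhead := 13 (only parsing).
Local Notation vkey := 14 (only parsing).
Local Notation vkids := 15 (only parsing).
Local Notation vsp := 16 (only parsing).
Local Notation vdown := 17 (only parsing).
Local Notation vy := 18 (only parsing).
Local Notation vf := 19 (only parsing).
Local Notation vx := 20 (only parsing).
Local Notation vc := 21 (only parsing).

Local Notation ROW := 0 (only parsing).
Local Notation RANK := 1 (only parsing).
Local Notation LAB := 2 (only parsing).
Local Notation VIS := 3 (only parsing).
Local Notation PAR := 4 (only parsing).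
Local Notation SCAN := 5 (only parsing).
Local Notation SKIP := 6 (only parsing).
Local Notation POS := 7 (only parsing).
Local Notation WT := 8 (only parsing).
Local Notation DEC := 9 (only parsing).
Local Notation NXT := 10 (only parsing).
Local Notation PREV := 11 (only parsing).
Local Notation TAB := 12 (only parsing).

(** The cell [key S + x] receives $c(S - x, x)$, while [key S + m] is reserved for $f(S)$. The
    nested subtractions give the indicator of [pos x < pos y], and [vf - (vf - vc)] is a minimum. *)
Definition leaf_step : prog :=
  vc ::= TAB@[$vkey -' WT@[$vy] +' $vx]
         +' (#1 -' (#1 -' (POS@[$vy] -' POS@[$vx])));;
  PPut TAB ($vkey +' $vx) $vc;;
  vc ::= TAB@[$vkey -' WT@[$vx] +' $vm] +' $vc;;
  vf ::= $vf -' ($vf -' $vc).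

(** The second leaf [vy] is the leaf visited just before [vx]. The first leaf has no predecessor and
    takes its successor, which is the top if the list has no other leaf. The start value of [vf]
    only has to be at least the cost of removing the head. *)
Definition solve : prog :=
  PIf ($vhead -' $va)
    (vy ::= NXT@[$vhead];;
     vf ::= TAB@[$vkey -' WT@[$vhead] +' $vm] +' $vm;;
     vx ::= $vhead;;
     PWhile ($vx -' $va) (leaf_step;; vy ::= $vx;; vx ::= NXT@[$vx]);;
     PIf ($vkids -' #1) PNop leaf_step;;
     PPut TAB ($vkey +' $vm) $vf)
    (PPut TAB ($vkey +' $vm) #0;; PPut TAB ($vkey +' $va) #0).

(** The new element is a leaf. If its parent is the head, the head stops being a leaf and is
    bypassed. With the top as head, [NXT a = a] makes the list end at the top. *)
Definition link : prog :=
  PIf ($vhead -' PAR@[$vi]) (PPut NXT $vi $vhead) (PPut NXT $vi NXT@[$vhead]).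

Definition push : prog :=
  PPut PREV $vi $vhead;;
  vhead ::= $vi;;
  vkey ::= $vkey +' WT@[$vi];;
  vkids ::= $vkids +' (#1 -' (PAR@[$vi] -' $va));;
  vi ::= $vi +' #1;;
  vdown ::= #1.

Definition pop : prog :=
  vkids ::= $vkids -' (#1 -' (PAR@[$vi] -' $va));;
  vkey ::= $vkey -' WT@[$vi];;
  vhead ::= PREV@[$vi];;
  vsp ::= $vsp -' #1.

(* A decision found on the stack has been to exclude [vi], unless [vi] is the
   last element of the current set. *)
Definition enum_step : prog :=
  PIf $vdown
    (PIf ($vend -' $vi)
       (PPut DEC $vsp $vi;; vsp ::= $vsp +' #1;; vi ::= SKIP@[$vi])
       (solve;; vdown ::= #0))
    (PIf $vsp
       (vi ::= DEC@[$vsp -' #1];;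
        PIf ($vi -' $vhead +' ($vhead -' $vi)) (link;; push) pop)
       (vrun ::= #0)).

Definition enumerate : prog :=
  vend ::= SKIP@[$va];; vhead ::= $va;; PPut NXT $va $va;; vkey ::= WT@[$va];;
  vkids ::= #0;; vsp ::= #0;; vi ::= $va +' #1;; vdown ::= #1;; vrun ::= #1;;
  PWhile $vrun enum_step.

Definition solve_all : prog :=
  va ::= $vm;;
  PWhile $va (va ::= $va -' #1;; enumerate);;
  vm ::= TAB@[$vwt -' #1].

(** Row offsets are tabulated by repeated addition. The accumulator ends at [m * m], where the
    ranking starts in the input. *)
Definition number : prog :=
  vi ::= #0;;
  PWhile ($vm -' $vi)
    (PPut ROW $vi $vacc;; vacc ::= $vacc +' $vm;; vi ::= $vi +' #1);;
  vi ::= #0;;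
  PWhile ($vm -' $vi)
    (PPut RANK (EInp ($vacc +' $vi)) $vi;; vi ::= $vi +' #1).

(** Accepting degree 0 covers the tree with a single vertex. *)
Definition find_root : prog :=
  vi ::= #0;;
  PWhile ($vm -' $vi)
    (vdeg ::= #0;; vj ::= #0;;
     PWhile ($vm -' $vj)
       (vdeg ::= $vdeg +' EInp (ROW@[$vi] +' $vj);; vj ::= $vj +' #1);;
     PIf ($vdeg -' #1) PNop (vroot ::= $vi);;
     vi ::= $vi +' #1).

Definition dfs_step : prog :=
  vw ::= SCAN@[$vu];;
  PIf ($vm -' $vw)
    (PPut SCAN $vu ($vw +' #1);;
     PIf (EInp (ROW@[LAB@[$vu]] +' $vw))
       (PIf VIS@[$vw] PNop
          (PPut VIS $vw #1;; PPut LAB $vcnt $vw;; PPut PAR $vcnt $vu;;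
           vu ::= $vcnt;; vcnt ::= $vcnt +' #1))
       PNop)
    (PPut SKIP $vu $vcnt;;
     PIf $vu (vu ::= PAR@[$vu]) (vrun ::= #0)).

Definition dfs : prog :=
  PPut LAB #0 $vroot;; PPut VIS $vroot #1;; vcnt ::= #1;; vu ::= #0;; vrun ::= #1;;
  PWhile $vrun dfs_step.

Definition weigh : prog :=
  vwt ::= $vm +' #1;; vi ::= #0;;
  PWhile ($vm -' $vi)
    (PPut POS $vi RANK@[LAB@[$vi]];; PPut WT $vi $vwt;;
     vwt ::= $vwt +' $vwt;; vi ::= $vi +' #1).

Definition swap_prog : prog :=
  number;; find_root;; dfs;; weigh;; solve_all.

Lemma leq_expn2r m n l : m <= n -> m ^ l <= n ^ l.
Proof. by move=> mn; case: l => [|l]; rewrite ?expn0 // leq_exp2r. Qed.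

(** * Connected sets of a rooted tree *)

Section RootedTree.

Implicit Types (S A B C o : seq nat) (x y z a : nat).

Variable par : nat -> nat.
Hypothesis par_lt : forall i, 0 < i -> par i < i.

Definition is_top (S : seq nat) x := (x == 0) || (par x \notin S).

(** In a rooted tree a nonempty set is connected exactly when one vertex only has no parent in
    it. *)
Definition conn (S : seq nat) : Prop :=
  {in S &, forall x y, is_top S x -> is_top S y -> x = y}.

Lemma eq_conn S S' : S =i S' -> conn S -> conn S'.
Proof.
move=> E cS x y; rewrite -!E => xS yS tx ty.
by apply: cS => //; rewrite /is_top E.
Qed.

(** Climbing from [z] to parents decreases and stays in [S] until a top is met, and that top must be
    [x]. *)
Lemma conn_top_le S x z : conn S -> x \in S -> is_top S x -> z \in S -> x <= z.
Proof.
move=> cS xS tx; have [n] := ubnP z; elim: n z => // n IHn z zn zS.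
case tz : (is_top S z); first by rewrite (cS x z).
move/negbT/norP: tz => [z0 /negPn pS]; have lt : par z < z by apply: par_lt; rewrite lt0n.
apply: leq_trans (ltnW lt); apply: IHn => //; lia.
Qed.

(** A top of the intersection is a top of [A] or of [B]. Two tops coming from different sets are
    each least in their own set, so they bound each other. *)
Lemma conn_inter A B C : conn A -> conn B ->
  (forall x, (x \in C) = (x \in A) && (x \in B)) -> conn C.
Proof.
move=> cA cB E x y; rewrite !E => /andP[xA xB] /andP[yA yB].
have H z : is_top C z -> is_top A z \/ is_top B z.
  by rewrite /is_top E negb_and; case: (z == 0) => /=; [left|case/orP; [left|right]].
case/H=> tx /H[] ty.
- exact: cA.
- by apply/eqP; rewrite eqn_leq (conn_top_le cA) ?(conn_top_le cB).
- by apply/eqP; rewrite eqn_leq (conn_top_le cB) ?(conn_top_le cA).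
- exact: cB.
Qed.

Lemma conn_rem2 S x y : uniq S -> conn (rem x S) -> conn (rem y S) ->
  conn (rem x (rem y S)).
Proof.
move=> uS cx cy; apply: conn_inter cx cy _ => z.
rewrite !mem_rem_uniq ?rem_uniq // !inE mem_rem_uniq // !inE.
by case: (z \in S); rewrite ?andbF ?andbT.
Qed.

(** * Optimal orders *)

Variable pos : nat -> nat.

Definition above (x : nat) (S : seq nat) := count (fun z => pos x < pos z) S.

(* An order lists candidates from the bottom to the top. *)
Fixpoint valid (o : seq nat) : Prop :=
  if o is x :: o' then conn o /\ valid o' else True.

Fixpoint cost (o : seq nat) : nat :=
  if o is x :: o' then above x o' + cost o' else 0.

Definition is_opt (S : seq nat) (d : nat) : Prop :=
  (exists o, [/\ perm_eq o S, valid o & cost o = d]) /\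
  forall o, perm_eq o S -> valid o -> d <= cost o.

Lemma conn_seq1 x : conn [:: x].
Proof. by move=> y z; rewrite !inE => /eqP-> /eqP->. Qed.

Lemma is_opt_seq1 x : is_opt [:: x] 0.
Proof.
split=> [|//]; exists [:: x]; split=> //=; split=> //; exact: conn_seq1.
Qed.

(** The dynamic programming step: a valid order of [S] begins with some [y] whose removal leaves a
    connected set, and its tail is a valid order of the rest. *)
Lemma is_opt_step S d : uniq S -> conn S ->
  (exists x d', [/\ x \in S, is_opt (rem x S) d' & d = d' + above x (rem x S)]) ->
  (forall x, x \in S -> conn (rem x S) ->
     exists2 d', is_opt (rem x S) d' & d <= d' + above x (rem x S)) ->
  is_opt S d.
Proof.
move=> uS cS [x [d' [xS [[o [po vo <-]] _] ->]]] H; split.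
  have pxo : perm_eq (x :: o) S.
    by rewrite perm_sym (perm_trans (perm_to_rem xS)) // perm_cons perm_sym.
  exists (x :: o); split=> //=.
    by split=> //; apply: eq_conn cS => z; rewrite (perm_mem pxo).
  by rewrite addnC /above (seq.permP po).
case=> [po0 _|y o' qo /= [co vo']].
  by have := perm_mem po0 x; rewrite xS.
have yS : y \in S by rewrite -(perm_mem qo) inE eqxx.
have po' : perm_eq o' (rem y S).
  rewrite -(perm_cons y); apply: perm_trans qo _; exact: perm_to_rem.
have co' : conn o' by case: {co qo po'} o' vo' => [_ ? ?|? ? []].
have [|d'' [_ /(_ _ po' vo') le1] le2] := H y yS.
  by apply: eq_conn co'; apply: perm_mem.
move: le2; rewrite /above -(seq.permP po') => le2; apply: leq_trans le2 _.
  by rewrite addnC leq_add2l.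
Qed.

(** * Connected sets with a given top *)

(* Connected sets are represented by decreasing lists; the last element [a] is
   the top. *)
Fixpoint conn_at (a : nat) (S : seq nat) : bool :=
  match S with
  | [::] => false
  | x :: S' =>
      if S' is h :: _ then [&& h < x, par x \in S' & conn_at a S'] else x == a
  end.

Lemma conn_at_inv a x h S : conn_at a [:: x, h & S] ->
  [/\ h < x, par x \in h :: S & conn_at a (h :: S)].
Proof. by move/and3P. Qed.

Lemma conn_at_cons a x S : conn_at a S ->
  conn_at a (x :: S) = (head 0 S < x) && (par x \in S).
Proof. by case: S => // h S /= ->; rewrite andbT. Qed.

Lemma conn_at_sorted a S : conn_at a S -> sorted gtn S.
Proof. by elim: S => // x [//|h S] IHS /and3P[hx _ /IHS /=->]; rewrite hx. Qed.

Lemma gtn_trans : transitive gtn.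
Proof. by move=> y x z /= xy yz; apply: ltn_trans yz xy. Qed.

Lemma sorted_gtn_uniq S : sorted gtn S -> uniq S.
Proof. by apply: sorted_uniq; [exact: gtn_trans|move=> x; exact: ltnn]. Qed.

Lemma conn_at_uniq a S : conn_at a S -> uniq S.
Proof. by move/conn_at_sorted/sorted_gtn_uniq. Qed.

Lemma conn_at_last a S : conn_at a S -> a \in S.
Proof.
elim: S => // x [_ /eqP->|h S IHS /and3P[_ _ /IHS aS]]; first by rewrite inE.
by rewrite in_cons aS orbT.
Qed.

Lemma conn_at_ge a S z : conn_at a S -> z \in S -> a <= z.
Proof.
elim: S z => // x [_ z /eqP->|h S IHS z]; first by rewrite inE => /eqP->.
case/and3P=> hx _ cS; rewrite inE => /orP[/eqP->|]; last exact: IHS.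
by rewrite (leq_trans _ (ltnW hx)) // IHS // inE eqxx.
Qed.

Lemma conn_at_le_head a S z : conn_at a S -> z \in S -> z <= head 0 S.
Proof.
elim: S z => // x [_ z /eqP->|h S IHS z]; first by rewrite inE => /eqP->.
case/and3P=> hx _ cS; rewrite inE => /orP[/eqP->//|zS].
by rewrite (leq_trans _ (ltnW hx)) // (IHS z).
Qed.

Lemma conn_at_par a S z : conn_at a S -> z \in S -> z != a -> par z \in S.
Proof.
elim: S z => // x [_ z /eqP->|h S IHS z]; first by rewrite inE => ->.
case/and3P=> hx pS cS; rewrite inE => /orP[/eqP-> _|zS za].
  by rewrite inE pS orbT.
by rewrite inE IHS ?orbT.
Qed.

Lemma conn_at_is_top a S : conn_at a S -> is_top S a.
Proof.
move=> cS; rewrite /is_top; case: (posnP a) => //= a0.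
apply/negP=> /(conn_at_ge cS); have := par_lt a0; lia.
Qed.

Lemma conn_at_top_eq a S z : conn_at a S -> z \in S -> is_top S z -> z = a.
Proof.
move=> cS zS tz; apply/eqP/negPn/negP => za.
have p := conn_at_par cS zS za; move: tz; rewrite /is_top p orbF => /eqP z0.
by have := conn_at_ge cS zS; move: za; rewrite z0; lia.
Qed.

Lemma conn_at_conn a S : conn_at a S -> conn S.
Proof.
move=> cS x y xS yS tx ty.
by rewrite (conn_at_top_eq cS xS tx) (conn_at_top_eq cS yS ty).
Qed.

Lemma sorted_gtn_last S z : sorted gtn S -> z \in S -> last 0 S <= z.
Proof.
elim: S z => // x [|y S] IHS z; first by move=> _; rewrite inE => /eqP->.
move=> /= /andP[yx s]; rewrite in_cons => /orP[/eqP->|]; last exact: IHS.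
by apply: leq_trans (ltnW yx); apply: IHS => //; rewrite inE eqxx.
Qed.

(** Every element but the top has its parent in [S]. Parents being smaller, the parent stands behind
    its child in a decreasing list. *)
Lemma conn_conn_at S : sorted gtn S -> conn S -> S != [::] -> conn_at (last 0 S) S.
Proof.
move=> sS cS S0; have a_min z : z \in S -> last 0 S <= z by apply: sorted_gtn_last.
have aS : last 0 S \in S by case: (S) S0 => // x S' _; rewrite /= mem_last.
have ta : is_top S (last 0 S).
  rewrite /is_top; case: (posnP (last 0 S)) => //= a0.
  by apply/negP=> /a_min; have := par_lt a0; lia.
have H z : z \in S -> z != last 0 S -> (par z \in S) && (0 < z).
  move=> zS za; have := a_min _ zS; rewrite leq_eqVlt eq_sym (negPf za) /= => az.
  rewrite (leq_ltn_trans _ az) // andbT; apply/negPn/negP=> pz; move/eqP: za; apply.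
  by apply: cS => //; rewrite /is_top pz orbT.
elim: S sS H S0 {cS a_min aS ta} => // x [|y S] IHS sS H _; first by rewrite /= eqxx.
have {}H z : z \in [:: x, y & S] -> z != last y S -> (par z \in [:: x, y & S]) && (0 < z).
  exact: H.
have lt z : z \in y :: S -> z < x.
  by move=> zS; have /allP/(_ z zS) := order_path_min gtn_trans sS.
have la : last y S < x by apply: lt; apply: mem_last.
have /andP[yx s] : (y < x) && sorted gtn (y :: S) by [].
apply/and3P; split=> //.
  have := H x; rewrite in_cons eqxx => /(_ isT); rewrite neq_ltn la orbT => /(_ isT).
  rewrite in_cons => /andP[/orP[/eqP p|//] x_gt0].
  by have := par_lt x_gt0; rewrite p; lia.
apply: IHS => // z zS za.
have := H z; rewrite in_cons zS orbT => /(_ isT za) /andP[].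
rewrite in_cons => /orP[/eqP p|->] z0 //.
by have := lt _ zS; have := par_lt z0; rewrite p; lia.
Qed.

Lemma is_top_rem a S z : conn_at a S -> is_top (rem z S) a.
Proof.
move=> cS; have := conn_at_is_top cS; rewrite /is_top => /orP[->//|p].
by apply/orP; right; apply: contra p; apply: mem_rem.
Qed.

(** This is why larger tops are treated earlier: a removal keeps the top or replaces it by a larger
    one. *)
Lemma conn_at_rem a S z : conn_at a S -> 1 < size S -> z \in S ->
  conn (rem z S) ->
  exists b, [/\ conn_at b (rem z S), z != a -> b = a & z = a -> a < b].
Proof.
move=> cS s1 zS cr; have nz : rem z S != [::].
  by rewrite -size_eq0 size_rem //; case: (size S) s1 => [|[]].
have sr : sorted gtn (rem z S).
  by apply: subseq_sorted (conn_at_sorted cS); [exact: gtn_trans|exact: rem_subseq].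
have ce := conn_conn_at sr cr nz; exists (last 0 (rem z S)); split=> //.
  move=> za; apply/esym/(conn_at_top_eq ce); last exact: is_top_rem.
  by rewrite mem_rem_uniq ?(conn_at_uniq cS) // inE eq_sym za (conn_at_last cS).
move=> za; have := conn_at_last ce.
rewrite mem_rem_uniq ?(conn_at_uniq cS) // inE za => /andP[ne /(conn_at_ge cS)].
by rewrite leq_eqVlt eq_sym (negPf ne).
Qed.

(** * Removable elements of a connected set *)

Definition kids a S := count (fun x => (x != a) && (par x == a)) S.

Lemma kids_cons a x S :
  kids a (x :: S) = ((x != a) && (par x == a)) + kids a S.
Proof. by []. Qed.

Lemma kids_gt0 a S : conn_at a S -> 1 < size S -> 0 < kids a S.
Proof.
elim: S => // x [//|h S] IHS /conn_at_inv[hx p cS] _.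
have hS : h \in h :: S by rewrite inE eqxx.
have ax : a < x := leq_ltn_trans (conn_at_ge cS hS) hx.
rewrite kids_cons; case: S {hS} cS p IHS => [|h' S] cS p IHS.
  by move: p cS; rewrite inE /= => /eqP-> /eqP->; rewrite eqxx andbT (gtn_eqF ax).
by rewrite addn_gt0 IHS ?orbT.
Qed.

(** Without [a], the new tops are precisely the children of [a] in [S]. *)
Lemma conn_rem_top a S : conn_at a S -> 1 < size S ->
  conn (rem a S) <-> kids a S = 1.
Proof.
move=> cS s1; have k0 := kids_gt0 cS s1; have uS := conn_at_uniq cS.
move: k0; rewrite /kids -size_filter; set l := filter _ S => l0.
have lP x : (x \in l) = [&& x != a, par x == a & x \in S].
  by rewrite mem_filter andbA.
have rP x : (x \in rem a S) = (x != a) && (x \in S) by rewrite mem_rem_uniq.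
have ul : uniq l by apply: filter_uniq.
split=> [c|].
  case: l lP ul l0 => [//|x [//|y l]] lP /= /andP[+ _] _; rewrite inE negb_or => /andP[xy _].
  have := lP x; have := lP y; rewrite !inE !eqxx orbT /=.
  case/esym/and3P=> ya py yS /esym/and3P[xa px xS].
  have T z : par z == a -> is_top (rem a S) z.
    by move=> /eqP pz; rewrite /is_top pz rP eqxx orbT.
  by move/eqP: xy; case; apply: c; rewrite ?rP ?xa ?ya ?T.
case: l lP {ul l0} => [//|b [|//]] lP _.
have H x : x \in rem a S -> is_top (rem a S) x -> x = b.
  rewrite rP /is_top => /andP[xa xS] tx; apply/eqP; rewrite -[_ == _](mem_seq1 x b) lP xa xS andbT.
  have px := conn_at_par cS xS xa; have ax := conn_at_ge cS xS; case/orP: tx => [/eqP x0|].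
    lia.
  by rewrite rP px andbT negbK.
by move=> x y xr yr tx ty; rewrite (H x) // (H y).
Qed.

Variables (m : nat) (skip : nat -> nat).
Hypothesis skip_gt : forall i, i < m -> i < skip i.
Hypothesis skip_le : forall i, i < m -> skip i <= m.
(* [i, skip i) is the subtree below i. *)
Hypothesis skipP : forall i j, i < j < m -> (j < skip i) = (i <= par j < skip i).

(** If [skip x] exceeded [skip i], the vertex [skip i] would lie below [x], so its parent would be
    at least [i]. As it does not lie below [i], its parent would even be at least [skip i], against
    [par_lt]. *)
Lemma skip_nest i x : i < m -> i <= x < skip i -> skip x <= skip i.
Proof.
move=> im /andP[ix xi]; have si := skip_le im; rewrite leqNgt; apply/negP=> lt.
have xm : x < m by lia.
have sx := skip_le xm; have jm : skip i < m by lia.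
have := @skipP x (skip i); rewrite xi jm => /(_ isT); rewrite lt => /esym/andP[p1 p2].
have := @skipP i (skip i); rewrite (skip_gt im) jm => /(_ isT).
rewrite ltnn (leq_trans ix p1) /= => /esym/negbT; rewrite -leqNgt.
have := @par_lt (skip i); have := skip_gt im; lia.
Qed.

(** Climbing from [y] inside [S] reaches a child of [z] before [z] itself. *)
Lemma conn_at_desc a S z y : conn_at a S -> head 0 S < m -> z \in S -> y \in S ->
  z < y < skip z -> exists2 c, c \in S & (c != a) && (par c == z).
Proof.
move=> cS Sm zS; have [n] := ubnP y; elim: n y => // n IHn y yn yS /andP[zy yz].
have ya : y != a by have := conn_at_ge cS zS; lia.
have pS := conn_at_par cS yS ya; have := conn_at_le_head cS yS => yh.
have := @skipP z y; rewrite zy (leq_ltn_trans yh Sm) yz => /(_ isT)/esym/andP[zp pz].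
case: (eqVneq (par y) z) => [E|ne]; first by exists y => //; rewrite ya E eqxx.
have lt : par y < y by apply: par_lt; lia.
by apply: (IHn (par y)) => //; lia.
Qed.

(* The top is left out, even when it is a leaf.  The list starts with the last
   element of S in preorder, so that adding or removing an element at the front
   of S changes only the front of the list. *)
Fixpoint leaves S :=
  if S is x :: S' then
    if S' is h :: _ then
      x :: (if par x == h then behead (leaves S') else leaves S')
    else [::]
  else [::].

Lemma leaves_cons x h S : leaves [:: x, h & S] =
  x :: (if par x == h then behead (leaves (h :: S)) else leaves (h :: S)).
Proof. by []. Qed.

Arguments leaves : simpl never.
Arguments conn_at : simpl never.
Arguments kids : simpl never.

Lemma leaves_subseq S : subseq (leaves S) S.
Proof.
elim: S => // x [//|h S] IHS; rewrite leaves_cons.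
by rewrite /= eqxx; case: ifP => _ //; apply: subseq_trans IHS; rewrite -drop1 drop_subseq.
Qed.

Lemma head_leaves S : 1 < size S -> leaves S = head 0 S :: behead (leaves S).
Proof. by case: S => [//|x [|h S]]. Qed.

(** Putting [x] in front can only cost [par x] its status as a leaf. If [par x] is not the head [h],
    it had lost that status before, because [h] lies below it. *)
Lemma leavesP a S z : conn_at a S -> head 0 S < m ->
  (z \in leaves S) = [&& z \in S, z != a & all (fun x => (x == a) || (par x != z)) S].
Proof.
elim: S => // x [_ /eqP-> _|h S IHS cxS xm].
  by rewrite !inE; case: eqP.
have [hx p cS] := conn_at_inv cxS; set S' := h :: S in p cS IHS cxS *.
have {}xm : x < m := xm; have hm : h < m by apply: ltn_trans hx xm.
have ah : a <= h by apply: (conn_at_ge cS); rewrite inE eqxx.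
rewrite leaves_cons in_cons.
case: (eqVneq z x) => [->|zx].
  rewrite orTb mem_head andTb; apply/esym/andP; split; first lia.
  apply/allP=> y yS; case: (eqVneq y a) => //= ya.
  have := conn_at_ge cxS yS; have := conn_at_le_head cxS yS => /= yx ay.
  by have := @par_lt y; lia.
have xa : (x == a) = false by lia.
rewrite in_cons (negPf zx) /= xa /=.
rewrite [X in _ = X](_ : _ = (par x != z) && (z \in leaves S')); last first.
  by rewrite IHS //; case: (z \in S'); case: (z == a); case: (par x == z).
case: ifP => [/eqP ph|/negbT ph].
  rewrite ph; case: S @S' p cS IHS cxS => [|h' S] S' p cS IHS cxS; first by rewrite andbF.
  rewrite (@head_leaves S') // in_cons [head 0 S']/= [h == z]eq_sym.
  have : uniq (leaves S') := subseq_uniq (leaves_subseq S') (conn_at_uniq cS).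
  rewrite (@head_leaves S') // cons_uniq => /andP[hl _].
  by case: (eqVneq z h) => // ->; rewrite (negPf hl).
case zl : (z \in leaves S'); last by rewrite andbF.
rewrite andbT; apply/esym/negP=> /eqP pz; move: zl; rewrite IHS // => /and3P[zS za /allP zc].
have x0 : 0 < x by lia.
(* Preorder puts [h] between [z] and its child [x], hence in the subtree of [z]; so [z] already had
   a child in [S']. *)
have zh : z < h.
  by have := conn_at_le_head cS zS; rewrite leq_eqVlt -pz (negPf ph).
have xz : x < skip z.
  rewrite skipP ?xm ?andbT; first by rewrite pz leqnn skip_gt //; lia.
  by rewrite -pz par_lt.
have hS : h \in S' by rewrite inE eqxx.
have [||c cS' /andP[ca cz]] := conn_at_desc cS _ zS hS _; [done|lia|].
by have := zc c cS'; rewrite (negPf ca) cz.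
Qed.

Lemma conn_rem_leaf a S z : conn_at a S -> head 0 S < m -> z \in S -> z != a ->
  conn (rem z S) <-> z \in leaves S.
Proof.
move=> cS Sm zS za; have uS := conn_at_uniq cS.
have rP x : (x \in rem z S) = (x != z) && (x \in S) by rewrite mem_rem_uniq.
rewrite (leavesP z cS Sm) zS za /=; split=> [c|/allP H].
  apply/allP=> x xS; apply/negPn/negP; rewrite negb_or negbK => /andP[xa /eqP pz].
  have x0 : 0 < x by have := conn_at_ge cS xS; lia.
  have xz : x != z by rewrite -pz; have := par_lt x0; lia.
  move/eqP: xa; case; apply: c.
  - by rewrite rP xz.
  - by rewrite rP eq_sym za (conn_at_last cS).
  - by rewrite /is_top pz rP eqxx orbT.
  - exact: is_top_rem.
have T x : x \in rem z S -> is_top (rem z S) x -> x = a.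
  rewrite rP /is_top => /andP[xz xS] tx; apply/eqP/negPn/negP=> xa.
  have px := conn_at_par cS xS xa; have := H x xS; rewrite (negPf xa) /= => pz.
  move: tx; rewrite rP px pz orbF => /eqP x0.
  by have := conn_at_ge cS xS; lia.
by move=> x y xr yr tx ty; rewrite (T x) // (T y).
Qed.

(** Distinct children of the top have disjoint subtrees, each with a leaf of [S]. The consequence
    used later is that a set with a single leaf in its list has a removable top. *)
Lemma kids_leaves a S : conn_at a S -> kids a S <= size (leaves S).
Proof.
elim: S => // x [_ /eqP->|h S IHS /conn_at_inv[hx p cS]]; first by rewrite /kids /= eqxx.
have := IHS cS; rewrite leaves_cons [kids a (x :: _)]kids_cons /=.
case: ifP => [/eqP ph|_]; last by case: (_ && _); lia.
case: S cS {p IHS} => [/eqP ha|h' S cS].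
  by rewrite ha (_ : kids a [:: a] = 0) ?addn0 //=; [case: (_ && _)|rewrite /kids /= eqxx].
have ne : (par x == a) = false.
  rewrite ph; have [h'h _ c'] := conn_at_inv cS.
  by have : a <= h' by [apply: (conn_at_ge c'); rewrite inE eqxx]; lia.
by rewrite ne andbF size_behead (@head_leaves [:: h, h' & S]) //=; lia.
Qed.

(** * Counting connected sets *)

Definition nleaves i e := count (fun x => skip x == x.+1) (iota i (e - i)).

Lemma nleaves_add i j e : i <= j <= e -> nleaves i e = nleaves i j + nleaves j e.
Proof.
case/andP=> ij je; rewrite /nleaves -count_cat (_ : e - i = (j - i) + (e - j)); last by lia.
by rewrite iotaD (_ : i + (j - i) = j) //; lia.
Qed.

Lemma nleaves_gt0 i : i < m -> 0 < nleaves i (skip i).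
Proof.
move=> im; have si := skip_gt im; have sm := skip_le im.
have [x xE] : exists x, skip i = x.+1 by exists (skip i).-1; lia.
rewrite -has_count; apply/hasP; exists x; first by rewrite mem_iota; lia.
have sx : skip x <= skip i by apply: skip_nest => //; lia.
by have : x < skip x by [apply: skip_gt; lia]; lia.
Qed.

(** The leaves of [S] have disjoint subtrees in the whole tree, and each subtree contains a leaf of
    the tree. *)
Lemma size_leaves a S : conn_at a S -> head 0 S < m -> size (leaves S) <= nleaves 0 m.
Proof.
move=> cS hm.
(* The second bound is needed when the head is replaced by its child: the other leaves are then paid
   for strictly before the head. *)
suff [H _] : size (leaves S) <= nleaves 0 (skip (head 0 S)) /\
             size (behead (leaves S)) <= nleaves 0 (head 0 S).
  by apply: leq_trans H _; rewrite (@nleaves_add 0 (skip (head 0 S)) m) ?leq_addr ?skip_le.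
elim: S cS hm => // x [//|h S] IHS cxS xm; have [hx p cS] := conn_at_inv cxS.
set S' := h :: S in p cS IHS cxS *; have hm : h < m by apply: ltn_trans hx xm.
have [IH1 IH2] := IHS cS hm.
rewrite leaves_cons [head 0 _]/=; set r := if _ then _ else _.
have H : size r <= nleaves 0 x.
  rewrite /r; case: ifP => [_|/negbT ph].
    by apply: leq_trans IH2 _; rewrite (@nleaves_add 0 h x) ?leq_addr //= ltnW.
  apply: leq_trans IH1 _; rewrite (@nleaves_add 0 (skip h) x) ?leq_addr //= leqNgt.
  apply/negP=> xs; have := @skipP h x; rewrite hx xm => /(_ isT); rewrite xs => /esym/andP[hp _].
  by have := conn_at_le_head cS p => /= ph'; move: ph; rewrite eqn_leq ph' hp.
split=> //=; rewrite (@nleaves_add 0 x (skip x)) /= ?(ltnW (skip_gt xm)) //.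
by rewrite -addn1 leq_add ?nleaves_gt0.
Qed.

(* Bounds the number of connected sets that extend a given one by elements of
   [i, e): excluding i leads to skip i, and including it to i + 1. *)
Definition extensions i e := (e - i).+1 ^ nleaves i e.

(** Let $q = e - i$ and let $l$ be the number of leaves in $[i+1, e)$. If [i] is a leaf, both terms
    are $q^l$ and the right side is $(q+1)^{l+1}$. Otherwise the skipped subtree holds one of the
    $l$ leaves, and the claim follows from $(q+1)^{l-1} + q (q+1)^{l-1} = (q+1)^l$. *)
Lemma extensions_rec i e : i < e -> e <= m -> skip i <= e ->
  extensions (skip i) e + extensions i.+1 e <= extensions i e.
Proof.
move=> ie em se; have im : i < m by lia.
have si := skip_gt im; rewrite /extensions (_ : (e - i.+1).+1 = e - i); last by lia.
set l := nleaves i.+1 e.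
have El : nleaves i e = (skip i == i.+1) + l.
  by rewrite (@nleaves_add i i.+1 e) ?ie ?leqnSn // /nleaves subSnn /= addn0.
have q0 : 0 < e - i by lia.
case: (eqVneq (skip i) i.+1) El => [E|ne] El.
  rewrite E El add1n expnS (_ : (e - i.+1).+1 = e - i) ?addnn -?mul2n; last by lia.
  by apply: leq_mul => //; apply: leq_expn2r.
have l_gt0 : 0 < l.
  have := nleaves_gt0 im; move: El; rewrite (@nleaves_add i (skip i) e); lia.
have le : nleaves (skip i) e <= l.-1.
  have := nleaves_gt0 im; move: El; rewrite (@nleaves_add i (skip i) e); lia.
rewrite El add0n -(prednK l_gt0) !expnS mulSn.
apply: leq_add; last by apply: leq_mul => //; apply: leq_expn2r.
apply: (@leq_trans ((e - skip i).+1 ^ l.-1)); first by apply: leq_pexp2l.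
apply: leq_expn2r; lia.
Qed.

(** * The table of partial solutions *)

(* The factor [m.+1] makes [key S + x], for [x <= m], determine both [S] and [x]. *)
Definition weight i := m.+1 * 2 ^ i.

Definition key S := \sum_(i <- S) weight i.

Lemma bits_lt x S : sorted gtn (x :: S) -> \sum_(i <- S) 2 ^ i < 2 ^ x.
Proof.
elim: S x => [|y S IHS] x; first by rewrite big_nil expn_gt0.
move=> /= /andP[yx s]; have {}IHS := IHS y s.
have : 2 ^ y.+1 <= 2 ^ x by apply: leq_pexp2l.
by rewrite big_cons expnS; lia.
Qed.

Lemma bits_inj S S' : sorted gtn S -> sorted gtn S' ->
  \sum_(i <- S) 2 ^ i = \sum_(i <- S') 2 ^ i -> S = S'.
Proof.
elim: S S' => [|x S IHS] [|x' S'] s s'; rewrite ?big_nil ?big_cons //.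
- by have := expn_gt0 2 x'; lia.
- by have := expn_gt0 2 x; lia.
have lt := bits_lt s; have lt' := bits_lt s'.
case: (ltngtP x x') => [xx'|xx'|<-].
- by have : 2 ^ x.+1 <= 2 ^ x' by [apply: leq_pexp2l]; rewrite expnS; lia.
- by have : 2 ^ x'.+1 <= 2 ^ x by [apply: leq_pexp2l]; rewrite expnS; lia.
move/addnI => E; congr (_ :: _); apply: IHS => //; [exact: path_sorted s|exact: path_sorted s'].
Qed.

Lemma key_inj S S' x x' : sorted gtn S -> sorted gtn S' -> x <= m -> x' <= m ->
  key S + x = key S' + x' -> S = S' /\ x = x'.
Proof.
move=> s s' xm xm'; rewrite /key -!big_distrr /=.
set b := \sum_(i <- S) _; set b' := \sum_(i <- S') _ => E.
have Eb : b = b'.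
  have := congr1 (divn^~ m.+1) E; rewrite ![m.+1 * _]mulnC !divnMDl // !divn_small //.
  by rewrite !addn0.
by split; [exact: bits_inj|move: E; rewrite Eb => /addnI].
Qed.

Lemma key_cons x S : key (x :: S) = weight x + key S.
Proof. exact: big_cons. Qed.

Lemma key_rem S x : x \in S -> key S = weight x + key (rem x S).
Proof. by move=> xS; rewrite /key (big_rem x). Qed.

Definition solved (tab : nat -> nat) S : Prop :=
  is_opt S (tab (key S + m)) /\
  forall x, x \in S -> conn (rem x S) -> tab (key S + x) = above x (rem x S).

(** By [key_inj] the cells of different sets form disjoint blocks. *)
Lemma eq_solved tab tab' S S' : sorted gtn S -> sorted gtn S' ->
  {in S', forall x, x < m} -> S' <> S ->
  (forall i, (forall z, z <= m -> i <> key S + z) -> tab' i = tab i) ->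
  solved tab S' -> solved tab' S'.
Proof.
move=> s s' Sm ne E [o c]; have H x : x <= m -> tab' (key S' + x) = tab (key S' + x).
  by move=> xm; apply: E => z zm /key_inj[].
split=> [|x xS cx]; first by rewrite H.
by rewrite H ?c // ltnW ?Sm.
Qed.

Lemma rem_rem S x y : uniq S -> rem x (rem y S) = rem y (rem x S).
Proof.
by move=> u; rewrite !rem_filter ?rem_uniq ?filter_uniq // -!filter_predI;
  apply: eq_filter => z /=; rewrite andbC.
Qed.

Lemma above_rem S x y : uniq S -> y \in S -> x != y ->
  above x (rem x S) = (pos x < pos y) + above x (rem x (rem y S)).
Proof.
move=> u yS xy; have yr : y \in rem x S by rewrite mem_rem_uniq // inE eq_sym xy.
by rewrite /above (seq.permP (perm_to_rem yr)) /= rem_rem.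
Qed.

(** * Correctness of the enumeration *)

Variable inp : nat -> nat.

Record static (h : env) : Prop := Static {
  static_m : var h vm = m;
  static_wt : var h vwt = m.+1 * 2 ^ m;
  static_par : arr h PAR = par;
  static_skip : arr h SKIP = skip;
  static_pos : arr h POS = pos;
  static_weight : forall i, i < m -> arr h WT i = weight i }.

Definition solve_frame S h h' : Prop :=
  [/\ forall v, v \notin [:: vdown; vy; vf; vx; vc] -> var h' v = var h v,
      forall t, t != TAB -> arr h' t = arr h t
    & forall i, (forall z, z <= m -> i <> key S + z) -> arr h' TAB i = arr h TAB i].

Lemma solve_frame_trans S h1 h2 h3 :
  solve_frame S h1 h2 -> solve_frame S h2 h3 -> solve_frame S h1 h3.
Proof.
case=> v1 a1 t1 [v2 a2 t2]; split=> [v Hv|t Ht|i Hi].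
- by rewrite v2 // v1.
- by rewrite a2 // a1.
- by rewrite t2 // t1.
Qed.

Lemma solve_frame_static S h h' : solve_frame S h h' -> static h -> static h'.
Proof.
by case=> Hv Ha _ []; split; rewrite ?Hv ?Ha.
Qed.

Lemma run_leaf_step S x y h : static h -> sorted gtn S -> {in S, forall z, z < m} ->
  var h vkey = key S -> var h vx = x -> var h vy = y ->
  x \in S -> y \in S -> x != y -> conn (rem x S) -> conn (rem y S) ->
  solved (arr h TAB) (rem x S) -> solved (arr h TAB) (rem y S) ->
  let h' := run inp leaf_step h in
  [/\ solve_frame S h h', var h' vx = x, var h' vy = y,
      arr h' TAB = update (arr h TAB) (key S + x) (above x (rem x S))
    & var h' vf = minn (var h vf) (arr h TAB (key (rem x S) + m) + above x (rem x S))].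
Proof.
move=> st sS Sm hk hx hy xS yS xy cx cy sx sy h'.
have uS := sorted_gtn_uniq sS; have xm := Sm _ xS; have ym := Sm _ yS.
have kx : key S - weight x = key (rem x S) by rewrite (key_rem xS) addKn.
have ky : key S - weight y = key (rem y S) by rewrite (key_rem yS) addKn.
have ab : arr h TAB (key (rem y S) + x) + (1 - (1 - (pos y - pos x))) = above x (rem x S).
  rewrite (proj2 sy) ?mem_rem_uniq ?inE ?xy //; last exact: conn_rem2.
  by rewrite (above_rem uS yS xy); case: ltnP; lia.
(* The cell with $f(S - x)$, read after the write, is not the one just written. *)
have ne : (key (rem x S) + m == key S + x) = false.
  apply/negP=> /eqP/key_inj[||//||E _].
  - by apply: subseq_sorted sS; [exact: gtn_trans|exact: rem_subseq].
  - by [].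
  - exact: ltnW.
  - have := size_rem xS; rewrite E; have := mem_rem_uniq x uS x.
    by rewrite E xS inE eqxx.
have -> : h' = Env (update (update (update (var h) vc (above x (rem x S))) vc
      (arr h TAB (key (rem x S) + m) + above x (rem x S))) vf
      (minn (var h vf) (arr h TAB (key (rem x S) + m) + above x (rem x S))))
    (arr (set_arr h TAB (key S + x) (above x (rem x S)))).
  rewrite /h' /= /set_var /set_arr /update /= hx hy hk (static_m st) (static_pos st).
  by rewrite !(static_weight st) // kx ky ab ne minnE.
split=> //; rewrite /= ?hx ?hy //; split=> [v|t /negPf /= ->//|i Hi] /=.
  by rewrite !inE !negb_or /update => /and5P[_ _ /negPf-> _ /negPf->].
by rewrite /update; case: eqP => // E; case: (Hi x (ltnW xm)).
Qed.

(** * The linked list of leaves and the solution of one set *)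

Fixpoint chain (nxt : nat -> nat) a l : Prop :=
  if l is z :: l' then nxt z = head a l' /\ chain nxt a l' else True.

(** Each element keeps the successor it received when it was the head. Entries further back are
    never changed while their owners are in [S], so dropping the head restores the earlier list. In
    the base case the top points to itself. *)
Fixpoint linked (nxt prev : nat -> nat) a S : Prop :=
  if S is x :: S' then
    if S' is h :: _ then
      [/\ nxt x = head a (behead (leaves S)), prev x = h & linked nxt prev a S']
    else nxt x = a
  else True.

Lemma linked_chain nxt prev a S : linked nxt prev a S -> chain nxt a (leaves S).
Proof.
elim: S => // x [//|h S] IHS [nx _ /IHS c]; rewrite leaves_cons /= in nx *.
by split=> //; case: ifP nx c => //; case: (leaves (h :: S)) => //= z l _ _ [].
Qed.

Definition removable tab S z : Prop :=
  [/\ z \in S, conn (rem z S) & solved tab (rem z S)].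

Lemma solve_frame_removable S h h' z : sorted gtn S -> {in S, forall x, x < m} ->
  solve_frame S h h' -> removable (arr h TAB) S z -> removable (arr h' TAB) S z.
Proof.
move=> sS Sm [_ _ Ht] [zS cz sz]; split=> //.
have sr : sorted gtn (rem z S).
  by apply: subseq_sorted sS; [exact: gtn_trans|exact: rem_subseq].
apply: (eq_solved sS sr) Ht sz => [x /mem_rem|E]; first exact: Sm.
by have := mem_rem_uniq z (sorted_gtn_uniq sS) z; rewrite E zS inE eqxx.
Qed.

Definition removal_cost tab S z := tab (key (rem z S) + m) + above z (rem z S).

Lemma solve_frame_removal_cost S h h' z : sorted gtn S -> z \in S ->
  solve_frame S h h' -> removal_cost (arr h' TAB) S z = removal_cost (arr h TAB) S z.
Proof.
move=> sS zS [_ _ Ht]; rewrite /removal_cost Ht // => x xm /key_inj[] //.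
  by apply: subseq_sorted sS; [exact: gtn_trans|exact: rem_subseq].
by move=> E; have := mem_rem_uniq z (sorted_gtn_uniq sS) z; rewrite E zS inE eqxx.
Qed.

(** [y] is the leaf treated just before [head a l]; that the two differ and are both removable is
    what [run_leaf_step] asks for. *)
Lemma leaf_loop S a l y h : static h -> sorted gtn S -> {in S, forall z, z < m} ->
  var h va = a -> var h vkey = key S -> var h vx = head a l -> var h vy = y ->
  chain (arr h NXT) a l -> uniq l -> {in l, forall z, a < z} -> y != head a l ->
  removable (arr h TAB) S y -> {in l, forall z, removable (arr h TAB) S z} ->
  runs inp (PWhile ($vx -' $va) (leaf_step;; vy ::= $vx;; vx ::= NXT@[$vx])) h
    (size l * 12).+1 (fun h' => [/\ solve_frame S h h', var h' vy = last y l,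
      var h' vx = a /\ var h' vf = foldl minn (var h vf)
                                     (map (removal_cost (arr h TAB) S) l),
      {in l, forall z, arr h' TAB (key S + z) = above z (rem z S)}
    & forall i, {in l, forall z, i <> key S + z} -> arr h' TAB i = arr h TAB i]).
Proof.
elim: l y h => [|z l IHl] y h st sS Sm ha hk hx hy hc ul al yl ry rl.
  by apply: runs_while_false; [rewrite /= hx ha subnn|split].
have [zS cz sz] := rl z (mem_head _ _); have [yS cy sy] := ry.
have zy : z != y by rewrite eq_sym.
have [fr rx' ry' rt rf] := run_leaf_step st sS Sm hk hx hy zS yS zy cz cy sz sy.
move: fr rx' ry' rt rf; have : run inp leaf_step h = run inp leaf_step h by [].
move: {-1}(run inp leaf_step h) => h1 E1 fr rx' ry' rt rf.
have [fv fa ft] := fr.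
rewrite (_ : (size (z :: l) * 12).+1 = (11 + (size l * 12).+1).+1); last by rewrite /=; lia.
apply: (@runs_while_true _ _ _ _ _ _ (fun h' => h' = set_var (set_var h1 vy z) vx (head a l))).
- by rewrite /= hx ha; have := al z (mem_head _ _) => /=; lia.
- apply: runs_run => //.
  rewrite [LHS](_ : _ = let h1 := run inp leaf_step h in
    set_var (set_var h1 vy (var h1 vx)) vx (arr h1 NXT (var h1 vx))) // E1 /=.
  by rewrite rx' fa //; have [-> _] := hc.
move=> h' -> {h'}; set h2 := set_var _ _ _.
have fr2 : solve_frame S h h2.
  split=> [v|//|//]; rewrite !inE !negb_or => Hv.
  rewrite /h2 /= /update; have [v1 v2 v3 v4 v5] := and5P Hv.
  by rewrite (negPf v2) (negPf v4) fv // !inE !negb_or v1 v2 v3 v4.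
have [fv2 fa2 ft2] := fr2.
have st2 := solve_frame_static fr2 st.
have /andP[zl ul'] := ul.
apply: runs_weaken (leqnn _) _; first apply: (IHl z h2) => //.
- by rewrite fv2.
- by rewrite fv2.
- by rewrite fa2 //; case: hc.
- by move=> x xl; apply: al; rewrite inE xl orbT.
- have := al z (mem_head _ _); case: (l) zl => [|x l'] /=; first lia.
  by rewrite inE negb_or => /andP[].
- exact: solve_frame_removable fr2 _.
- move=> x xl; apply: solve_frame_removable fr2 _ => //.
  by apply: rl; rewrite inE xl orbT.
have Ec x : x \in S -> removal_cost (arr h2 TAB) S x = removal_cost (arr h TAB) S x.
  by move=> xS; apply: solve_frame_removal_cost fr2.
move=> h' [fr' ly lx lt lo]; have [lx1 lx2] := lx; split=> //.
- exact: solve_frame_trans fr2 fr'.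
- split=> //; rewrite lx2 -[var h2 vf]/(var h1 vf) rf; congr (foldl minn _ _).
  apply/eq_in_map => x xl; apply: Ec; have [] // := rl x; by rewrite inE xl orbT.
- move=> x; rewrite inE => /orP[/eqP->|]; last exact: lt.
  rewrite lo; last by move=> x' x'l /addnI E; rewrite -E in x'l; rewrite x'l in zl.
  by rewrite /h2 /= rt /= /update eqxx.
- move=> i Hi; rewrite lo; last by move=> x xl; apply: Hi; rewrite inE xl orbT.
  by rewrite /h2 /= rt /= /update; case: eqP => // E; case: (Hi z); rewrite ?inE ?eqxx.
Qed.

Lemma foldl_minn f l :
  [/\ foldl minn f l <= f, {in l, forall v, foldl minn f l <= v}
    & foldl minn f l = f \/ foldl minn f l \in l].
Proof.
elim: l f => [|v l IHl] f /=; first by split=> //; left.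
have [le lel eq] := IHl (minn f v); have := geq_minl f v; have := geq_minr f v.
move=> lv lf; split; first exact: leq_trans le lf.
  by move=> v'; rewrite inE => /orP[/eqP->|/lel//]; apply: leq_trans le lv.
case: eq => [->|H]; last by right; rewrite inE H orbT.
by rewrite /minn; case: ifP; [left|right; rewrite inE eqxx].
Qed.

Lemma above_le S x : uniq S -> {in S, forall z, z < m} -> above x S <= m.
Proof.
move=> uS Sm; apply: leq_trans (count_size _ _) _.
rewrite -[m](size_iota 0); apply: uniq_leq_size => // z /Sm; by rewrite mem_iota.
Qed.

Lemma solve_seq1 a h : a < m -> static h -> var h va = a -> var h vkey = key [:: a] ->
  var h vhead = a ->
  runs inp solve h 30 (fun h' => solve_frame [:: a] h h' /\ solved (arr h' TAB) [:: a]).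
Proof.
move=> am st ha hk hh; rewrite -[30]/29.+1; apply: runs_if => [|_].
  by rewrite /= hh ha subnn.
apply: runs_run => //=; split; first split=> //=.
- by move=> t /negPf->.
- move=> i Hi; rewrite /update ha hk (static_m st).
  case: eqP => [E|_]; first by case: (Hi a (ltnW am)).
  by case: eqP => [E|//]; case: (Hi m (leqnn m)).
split; first by rewrite /update ha hk (static_m st) eqxx if_same; apply: is_opt_seq1.
by move=> x; rewrite inE => /eqP-> _; rewrite /update ha hk eqxx /= eqxx.
Qed.

Lemma solve_ok S a h : a < m -> static h -> conn_at a S -> head 0 S < m ->
  var h va = a -> var h vkey = key S -> var h vhead = head 0 S ->
  var h vkids = kids a S -> linked (arr h NXT) (arr h PREV) a S ->
  {in S, forall z, 1 < size S -> conn (rem z S) -> solved (arr h TAB) (rem z S)} ->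
  runs inp solve h (nleaves 0 m * 12 + 40)
    (fun h' => solve_frame S h h' /\ solved (arr h' TAB) S).
Proof.
move=> am st cS hm ha hk hh hc hl HS; have sS := conn_at_sorted cS.
have uS := conn_at_uniq cS.
have Sm : {in S, forall z, z < m}.
  by move=> z zS; apply: leq_ltn_trans hm; apply: (conn_at_le_head cS).
case: (leqP (size S) 1) => [s1|s1].
  case: S s1 cS hk hh {hm hc hl HS sS uS Sm} => [//|x [|//]] _ /eqP-> hk hh.
  by apply: runs_weaken (solve_seq1 am st ha hk hh) _ _ => //; lia.
have {}HS z : z \in S -> conn (rem z S) -> removable (arr h TAB) S z.
  by move=> zS cz; split=> //; apply: HS.
have ax x : x \in leaves S -> a < x.
  rewrite (leavesP x cS hm) => /and3P[xS xa _].
  by have := conn_at_ge cS xS; rewrite leq_eqVlt eq_sym (negPf xa).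
have lx x : x \in leaves S -> removable (arr h TAB) S x.
  move=> xl; have xS := mem_subseq (leaves_subseq S) xl; apply: HS => //.
  by apply/(conn_rem_leaf cS hm xS) => //; have := ax _ xl; lia.
have ul : uniq (leaves S) := subseq_uniq (leaves_subseq S) uS.
have El := head_leaves s1; set hd := head 0 S in hh El.
have hdl : hd \in leaves S by rewrite El mem_head.
have hdS := mem_subseq (leaves_subseq S) hdl.
have k0 := kids_gt0 cS s1.
have k1P : (kids a S - 1 == 0) = (kids a S == 1) by move: (kids a S) k0 => [|[]].
have kl := kids_leaves cS.
have aS := conn_at_last cS.
have ra : kids a S = 1 -> removable (arr h TAB) S a.
  by move=> k1; apply: HS => //; apply/conn_rem_top.
have hch := linked_chain hl.
set y0 := arr h NXT hd.
have y0E : y0 = head a (behead (leaves S)) by move: hch; rewrite El => -[].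
(* When the head is the only leaf in the list, its successor is the top, which [kids_leaves] then
   shows to have one child and so to be removable. *)
have ry0 : removable (arr h TAB) S y0.
  rewrite y0E; case E : (behead (leaves S)) => [|y r] /=.
    by apply: ra; move: kl; rewrite El E /=; lia.
  by apply: lx; rewrite El E !inE eqxx orbT.
have y0hd : y0 != hd.
  rewrite y0E; case E : (behead (leaves S)) => [|y r] /=.
    by rewrite ltn_eqF // ax.
  by move: ul; rewrite El E /= inE negb_or eq_sym => /andP[/andP[]].
set f0 := arr h TAB (key (rem hd S) + m) + m.
set h1 := set_var (set_var (set_var h vy y0) vf f0) vx hd.
rewrite /solve (_ : nleaves 0 m * 12 + 40 = (nleaves 0 m * 12 + 39).+1); last by lia.
apply: runs_if => [_|]; last first.
  by move/eqP; rewrite /= hh ha subn_eq0 leqNgt ax.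
have sl := size_leaves cS hm.
apply: (@runs_le _ _ _ (1 + (1 + (1 + ((size (leaves S) * 12).+1 + (9 + 1)))))); last by lia.
do 3 (apply: runs_seq_run => //).
rewrite [X in runs _ _ X](_ : _ = h1); last first.
  rewrite /h1 /y0 /f0 /= /set_var /update /= hh hk (static_weight st) ?(static_m st) ?Sm //.
  by rewrite (key_rem hdS) addKn.
have fr1 : solve_frame S h h1.
  split=> // v; rewrite !inE !negb_or => /and5P[v1 v2 v3 v4 v5].
  by rewrite /= /update (negPf v2) (negPf v3) (negPf v4).
have hdE : head a (leaves S) = hd by rewrite El.
have y0hd' : y0 != head a (leaves S) by rewrite hdE.
have lp := @leaf_loop S a (leaves S) y0 h1 (solve_frame_static fr1 st) sS Sm ha hk
  (esym hdE) erefl hch ul ax y0hd' ry0 lx.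
apply: runs_seq lp _ => h2 [fr2 hy2 [hx2 hf2] ht2 ho2].
have fr12 := solve_frame_trans fr1 fr2; have [fv fa ft] := fr12.
set y := last y0 (leaves S) in hy2.
have yl : y \in leaves S by rewrite /y El /= mem_last.
have st2 := solve_frame_static fr12 st.
have hk2 : var h2 vkey = key S by rewrite fv.
have rm z : removable (arr h TAB) S z -> removable (arr h2 TAB) S z.
  exact: solve_frame_removable fr12.
set rc := removal_cost (arr h TAB) S.
(* All removable elements: the loop handles the list, and the extra [leaf_step] the top. *)
pose ll := leaves S ++ (if kids a S == 1 then [:: a] else [::]).
have llP z : z \in ll <-> z \in S /\ conn (rem z S).
  rewrite /ll mem_cat; split=> [/orP[/lx[]//|]|[zS cz]].
    by case: eqP => // k1; rewrite inE => /eqP->; have [] := ra k1.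
  case: (eqVneq z a) => [E|za]; last by move/(conn_rem_leaf cS hm zS za): cz => ->.
  by move: cz; rewrite E => /(conn_rem_top cS s1)->; rewrite inE !eqxx orbT.
apply: (@runs_seq _ _ _ _ _ _ (fun h3 => [/\ solve_frame S h h3,
   var h3 vf = foldl minn f0 (map rc ll)
   & {in ll, forall z, arr h3 TAB (key S + z) = above z (rem z S)}])).
  apply: runs_if => [kn|k1].
    apply: runs_run => //=; split=> //; move: kn; rewrite /= fv // hc k1P => /negPf kn.
      by rewrite /ll kn cats0 hf2.
    by rewrite /ll kn cats0.
  apply: runs_run => //.
  have {}k1 : kids a S = 1 by apply/eqP; rewrite -k1P; apply/eqP; move: k1; rewrite /= fv // hc.
  have [_ ca sa] := rm _ (ra k1); have [yS cy sy] := rm _ (lx _ yl).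
  have ay : a != y by rewrite ltn_eqF // ax.
  have -> : ll = leaves S ++ [:: a] by rewrite /ll k1 eqxx.
  have [] := run_leaf_step st2 sS Sm hk2 hx2 hy2 aS yS ay ca cy sa sy.
  move: (run inp leaf_step h2) => h3 fr3 _ _ ht3 hf3; split.
  - exact: solve_frame_trans fr12 fr3.
  - by rewrite hf3 hf2 map_cat foldl_cat /= /rc -(solve_frame_removal_cost sS aS fr12).
  - move=> z; rewrite mem_cat inE ht3 /= /update eqn_add2l.
    case: eqVneq => [-> //|za]; rewrite orbF; exact: ht2.
move=> h3 [fr3 hf3 ht3]; have [fv3 _ _] := fr3.
have st3 := solve_frame_static fr3 st.
apply: runs_run => //; split.
  apply: solve_frame_trans fr3 _; split=> //= [t /negPf->//|i Hi].
  by rewrite /update fv3 // hk (static_m st3); case: eqP => // E; case: (Hi m).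
rewrite /= /update fv3 // hk (static_m st3).
have [fle fll feq] := foldl_minn f0 (map rc ll).
have rcP z : z \in ll -> is_opt (rem z S) (arr h TAB (key (rem z S) + m)).
  by case/llP=> zS cz; have [_ _ []] := HS _ zS cz.
have hdll : hd \in ll by rewrite /ll mem_cat hdl.
split.
  rewrite eqxx hf3; apply: is_opt_step => //; first exact: conn_at_conn cS.
    (* If the minimum is the start value [f0], then [f0] is at most the cost of removing the head,
       and at least that cost because [above] is at most [m]. So the head attains it. *)
    case: feq => [feq|/mapP[z zl ->]]; last first.
      exists z, (arr h TAB (key (rem z S) + m)); split=> //; last exact: rcP.
      by have /llP[] := zl.
    exists hd, (arr h TAB (key (rem hd S) + m)); split=> //; first exact: rcP.
    apply/eqP; rewrite eqn_leq (fll (rc hd)) ?map_f //= feq leq_add2l.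
    apply: above_le; first exact: rem_uniq.
    by move=> z /mem_rem/Sm.
  move=> z zS cz; have zl : z \in ll by apply/llP.
  by exists (arr h TAB (key (rem z S) + m)); [exact: rcP|exact: fll (map_f rc zl)].
move=> z zS cz; have zl : z \in ll by apply/llP.
by rewrite eqn_add2l ltn_eqF ?Sm // ht3.
Qed.

(** * The binary decisions for a fixed top *)

Lemma conn_at_lt_skip a S z : a < m -> conn_at a S -> head 0 S < m -> z \in S ->
  z < skip a.
Proof.
move=> am cS Sm; have [n] := ubnP z; elim: n z => // n IHn z zn zS.
have [->|za] := eqVneq z a; first exact: skip_gt.
have az := conn_at_ge cS zS; have zm := leq_ltn_trans (conn_at_le_head cS zS) Sm.
have az' : a < z by rewrite ltn_neqAle eq_sym za.
have pS := conn_at_par cS zS za; have pz : par z < z by apply: par_lt; lia.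
by rewrite skipP ?az' // (conn_at_ge cS pS) IHn //; lia.
Qed.

(** Excluding [i] excludes everything below it, which justifies the jump to [skip i]. *)
Lemma conn_at_anc a S i z : conn_at a S -> head 0 S < m -> a < i -> z \in S ->
  i <= z < skip i -> i \in S.
Proof.
move=> cS Sm ai; have [n] := ubnP z; elim: n z => // n IHn z zn zS /andP[iz zi].
have [->//|ne] := eqVneq i z; have zm := leq_ltn_trans (conn_at_le_head cS zS) Sm.
have {ne}iz' : i < z by rewrite ltn_neqAle ne.
have pz : par z < z by apply: par_lt; lia.
apply: (IHn (par z)); first lia; first by apply: (conn_at_par cS) => //; lia.
by rewrite -skipP ?iz'.
Qed.

Lemma filter_gtnS S i : sorted gtn S ->
  filter (gtn i.+1) S = if i \in S then i :: filter (gtn i) S else filter (gtn i) S.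
Proof.
move=> sS; case: ifP => iS; last first.
  apply: eq_in_filter => z zS /=; rewrite ltnS leq_eqVlt.
  by case: eqP => // E; rewrite -E zS in iS.
elim: S sS iS => // x S IHS /= sS; rewrite inE => /orP[/eqP->|iS].
  rewrite ltnSn ltnn; congr (_ :: _); apply: eq_in_filter => z zS /=.
  by have /allP/(_ z zS) /= := order_path_min gtn_trans sS; lia.
have /allP/(_ i iS) /= ix := order_path_min gtn_trans sS.
by rewrite ltnS leqNgt ix /= ltnNge (ltnW ix) /= IHS // (path_sorted sS).
Qed.

Lemma filter_gtn_skip a S i : conn_at a S -> head 0 S < m -> a < i -> i < m ->
  i \notin S -> filter (gtn (skip i)) S = filter (gtn i) S.
Proof.
move=> cS Sm ai im iS; apply: eq_in_filter => z zS /=.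
case: (ltnP z i) => [zi|iz]; first exact: ltn_trans zi (skip_gt im).
by apply/negP=> zi; case/negP: iS; apply: (conn_at_anc cS) zS _ => //; rewrite iz.
Qed.

(** [vi] is left out: it matters only on the way down, and on the way up it is read from the stack
    again. *)
Record inner a S sp (D : nat -> nat) down (h : env) : Prop := Inner {
  inner_static : static h;
  inner_a : var h va = a;
  inner_end : var h vend = skip a;
  inner_run : var h vrun = 1;
  inner_down : var h vdown = down;
  inner_head : var h vhead = head 0 S;
  inner_key : var h vkey = key S;
  inner_kids : var h vkids = kids a S;
  inner_sp : var h vsp = sp;
  inner_linked : linked (arr h NXT) (arr h PREV) a S;
  inner_dec : forall j, j < sp -> arr h DEC j = D j }.

Lemma eq_linked nxt prev nxt' prev' a S :
  {in S, nxt =1 nxt'} -> {in S, prev =1 prev'} ->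
  linked nxt prev a S -> linked nxt' prev' a S.
Proof.
elim: S => // x [|h S] IHS En Ep /=; first by rewrite En ?inE.
case=> nx px l; rewrite -En ?mem_head // -Ep ?mem_head //; split=> //.
by apply: IHS l => z zS; [apply: En|apply: Ep]; rewrite inE zS orbT.
Qed.

Lemma exclude_ok a S sp D h i : inner a S sp D 1 h -> var h vi = i -> i < skip a ->
  runs inp enum_step h 40 (fun h' => [/\ inner a S sp.+1 (update D sp i) 1 h',
    var h' vi = skip i & arr h' TAB = arr h TAB]).
Proof.
case=> -[s1 s2 s3 s4 s5 s6] ia ie ir id ih ik ic isp il idc hi lt.
rewrite -[40]/39.+1; apply: runs_if => [_|]; last by rewrite /= id.
rewrite -[39]/38.+1; apply: runs_if => [_|]; last by rewrite /= ie hi; lia.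
apply: runs_run => //; split=> //=; last by rewrite s4 /update /= hi.
split=> //=; first by rewrite /update /= isp addn1.
move=> j js; rewrite /update isp hi; case: eqP => // ne; apply: idc; lia.
Qed.

Lemma include_ok a S sp D h i : a < i -> i < m -> conn_at a S -> head 0 S < i ->
  par i \in S -> inner a S sp.+1 D 0 h -> D sp = i ->
  runs inp enum_step h 40 (fun h' => [/\ inner a (i :: S) sp.+1 D 1 h',
    var h' vi = i.+1 & arr h' TAB = arr h TAB]).
Proof.
move=> ai im cS hi pS [[s1 s2 s3 s4 s5 s6] ia ie ir id ih ik ic isp il idc] Di.
rewrite -[40]/39.+1; apply: runs_if => [|_]; first by rewrite /= id.
rewrite -[39]/38.+1; apply: runs_if => [_|]; last by rewrite /= isp.
apply: runs_run => //.
have -> : run inp (vi ::= DEC@[$vsp -' #1];;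
        PIf ($vi -' $vhead +' ($vhead -' $vi)) (link;; push) pop) h =
    run inp (link;; push) (set_var h vi i).
  rewrite /= isp subn1 /= idc // Di /set_var /update /= ih.
  by case: eqP => //; lia.
have iS : i \notin S by apply/negP=> /(conn_at_le_head cS); lia.
have aS := conn_at_ge cS pS; have ph := conn_at_le_head cS pS.
have El : head a (behead (leaves (i :: S))) =
    if head 0 S - par i == 0 then arr h NXT (head 0 S) else head 0 S.
  case: S cS {hi iS} pS ph il {ih ik ic} => [//|x S] cS pS ph il; rewrite leaves_cons /=.
  have -> : (x - par i == 0) = (par i == x) by move: ph => /=; lia.
  case: S cS pS ph il => [|y S] cS pS ph il; last first.
    by case: ifP => //; case: il => -> _ _.
  by move: pS il; rewrite inE => -> /=.
set v := head a (behead _) in El.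
have -> : run inp (link;; push) (set_var h vi i) =
    run inp push (set_arr (set_var h vi i) NXT i v).
  rewrite [LHS](_ : _ = run inp push (run inp link (set_var h vi i))) //.
  by congr (run inp push _); rewrite /= /update /= s3 ih El; case: ifP.
case: S cS iS pS hi aS il ih ik ic {ph El} @v => [//|x S] cS iS pS hi aS il ih ik ic v.
have Ek : kids a (x :: S) + (1 - (par i - a)) = kids a [:: i, x & S].
  by rewrite [RHS]kids_cons addnC (gtn_eqF ai) /=; congr (_ + _); case: eqP => [->|ne] /=; lia.
split.
- split=> //; rewrite ?[_ push _]/= /update /=.
  + by rewrite /update /= ik s6 // (key_cons i) addnC.
  + by rewrite /update /= ic s3 ia.
  + split; [by rewrite /update eqxx /v leaves_cons|by rewrite /update eqxx ih|].
    have U f w : {in x :: S, f =1 update f i w}.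
      by move=> z zS; rewrite /update; case: eqP => // E; rewrite -E zS in iS.
    exact: (@eq_linked _ _ _ _ a (x :: S) (U _ _) (U _ _)).
- by rewrite /= addn1.
- by [].
Qed.

(** Undoes the inclusion of [i]. [PREV] gives back the head, and [NXT] needs no repair since the
    entries of [S] still hold. *)
Lemma exclude_again a S i sp D h : i \notin S -> conn_at a S -> conn_at a (i :: S) ->
  i < m -> D sp = i -> inner a (i :: S) sp.+1 D 0 h ->
  runs inp enum_step h 40 (fun h' => inner a S sp D 0 h' /\ arr h' TAB = arr h TAB).
Proof.
move=> iS cS ciS im Di [[s1 s2 s3 s4 s5 s6] ia ie ir id ih ik ic isp il idc].
rewrite -[40]/39.+1; apply: runs_if => [|_]; first by rewrite /= id.
rewrite -[39]/38.+1; apply: runs_if => [_|]; last by rewrite /= isp.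
apply: runs_run => //.
have -> : run inp (vi ::= DEC@[$vsp -' #1];;
        PIf ($vi -' $vhead +' ($vhead -' $vi)) (link;; push) pop) h =
    run inp pop (set_var h vi i).
  by rewrite /= isp subn1 /= idc // Di /set_var /update /= ih /= subnn.
case: S cS iS ciS il ih ik ic => [//|x S] cS iS ciS [_ pi il] ih ik ic.
have [xi pS _] := conn_at_inv ciS.
have Ek : kids a [:: i, x & S] - (1 - (par i - a)) = kids a (x :: S).
  have ai : a < i := leq_ltn_trans (conn_at_ge cS (mem_head x S)) xi.
  have ap := conn_at_ge cS pS; rewrite (kids_cons a i) (gtn_eqF ai) /=.
  by case: eqP => [->|ne] /=; [rewrite subnn|have -> : 1 - (par i - a) = 0 by lia];
    rewrite ?subn0 ?addKn.
split=> //; split=> //.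
- by rewrite /= /update /= ik s6 // (key_cons i) addKn.
- by rewrite /= /update /= ic s3 ia Ek.
- by rewrite /= /update /= isp subn1.
- by move=> j js; rewrite /= idc //; lia.
Qed.

Definition solve_time := nleaves 0 m * 12 + 50.

Definition grows h h' : Prop := forall b S, conn_at b S -> head 0 S < m ->
  solved (arr h TAB) S -> solved (arr h' TAB) S.

Lemma solve_step_ok a S sp D h : a < m -> conn_at a S -> head 0 S < m ->
  inner a S sp D 1 h -> var h vi = skip a ->
  {in S, forall z, 1 < size S -> conn (rem z S) -> solved (arr h TAB) (rem z S)} ->
  runs inp enum_step h solve_time
    (fun h' => [/\ inner a S sp D 0 h', grows h h' & solved (arr h' TAB) S]).
Proof.
move=> am cS hm [st ia ie ir id ih ik ic isp il idc] hi HS.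
have -> : solve_time = (nleaves 0 m * 12 + 49).+1 by rewrite /solve_time addnS.
apply: runs_if => [_|]; last by rewrite /= id.
have -> : nleaves 0 m * 12 + 49 = (nleaves 0 m * 12 + 48).+1 by rewrite addnS.
apply: runs_if => [|_]; first by rewrite /= ie hi subnn.
apply: (@runs_le _ _ _ (nleaves 0 m * 12 + 40 + 1)); last by rewrite -addnA leq_add2l.
apply: runs_seq (solve_ok am st cS hm ia ik ih ic il HS) _ => h' [fr sv].
have [fv fa ft] := fr; apply: runs_run => //; split=> //.
- split=> //=; rewrite /update ?fv ?fa //; first by case: (solve_frame_static fr st).
- move=> b S' cS' hm' sv'; have sS' := conn_at_sorted cS'.
  have [->//|ne] := eqVneq S' S.
  apply: (eq_solved (conn_at_sorted cS) sS') ft sv'; last exact/eqP.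
  by move=> x xS; apply: leq_ltn_trans hm'; apply: conn_at_le_head cS' xS.
Qed.

(** A binary tree with $N$ outcomes has $N - 1$ inner nodes. An outcome costs [solve_time.+1]; an
    inner node costs three steps of 41, to exclude, to include and to undo. The sum is
    [(solve_time + 124) * N - 123]. *)
Definition enum_time i e := (solve_time + 124) * extensions i e - 123.

Lemma enum_time_rec i e : i < e -> e <= m -> skip i <= e ->
  41 + (enum_time (skip i) e + (41 + (enum_time i.+1 e + 41))) <= enum_time i e.
Proof.
move=> ie em se; have := extensions_rec ie em se.
have X0 j : 0 < extensions j e by rewrite expn_gt0.
have H j : solve_time + 124 <= (solve_time + 124) * extensions j e by apply: leq_pmulr.
rewrite -(leq_pmul2l (_ : 0 < solve_time + 124)) ?addn_gt0 ?orbT // mulnDr.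
by have := H (skip i); have := H i.+1; rewrite /enum_time; lia.
Qed.

Lemma enum_last a S sp D h : a < m -> conn_at a S -> head 0 S < skip a ->
  inner a S sp D 1 h -> var h vi = skip a ->
  (forall b S', a < b -> conn_at b S' -> head 0 S' < m -> solved (arr h TAB) S') ->
  (forall S', conn_at a S' -> head 0 S' < m ->
     {subset filter (gtn (skip a)) S' <= S} -> filter (gtn (skip a)) S' <> S ->
     solved (arr h TAB) S') ->
  reach inp $vrun enum_step h (enum_time (skip a) (skip a)) (fun h' =>
    [/\ inner a S sp D 0 h', grows h h' &
        forall S', conn_at a S' -> head 0 S' < m -> filter (gtn (skip a)) S' = S ->
          solved (arr h' TAB) S']).
Proof.
move=> am cS hi inn vi_i Hb Hs; have em := skip_le am.
have hm : head 0 S < m by apply: leq_trans em.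
(* Removing the top leads to a larger top, covered by [Hb]; any other removal leads to a proper
   subset with the same top, covered by [Hs]. *)
have HS : {in S, forall z, 1 < size S -> conn (rem z S) -> solved (arr h TAB) (rem z S)}.
  move=> z zS s1 cz; have [b [cb ba ab]] := conn_at_rem cS s1 zS cz.
  have hr : head 0 (rem z S) < m.
    apply: leq_ltn_trans hm; apply: (conn_at_le_head cS); apply: (@mem_rem _ z).
    by case: (rem z S) cb => // x l _; apply: mem_head.
  have [za|za] := eqVneq z a; first exact: Hb (ab za) cb hr.
  move: cb; rewrite (ba za) => cb; apply: Hs => // [y|E].
    by rewrite mem_filter => /andP[_ /mem_rem].
  move: zS; rewrite -E mem_filter => /andP[_].
  by rewrite mem_rem_uniq ?(conn_at_uniq cS) // inE eqxx.
apply: reach_weaken (reach_step _ (solve_step_ok am cS hm inn vi_i HS)) _ _.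
- by rewrite /= (inner_run inn).
- by rewrite /enum_time /extensions subnn exp1n muln1; lia.
- move=> h' [inn' gr sv]; split=> // S' cS' hm' E.
  suff -> : S' = S by [].
  rewrite -E; apply/esym/all_filterP/allP => z zS.
  exact: conn_at_lt_skip cS' hm' zS.
Qed.

(** All vertices before [i] are decided, and [S] records the decisions. The condition on parents
    says that every undecided vertex hanging from the decided part hangs from [S], so that [i] can
    be included. The last hypothesis says that all sets whose decided part is a proper subset of [S]
    are solved; it survives inclusion because exclusion comes first. *)
Lemma enum_ok n a i S sp D h : skip a - i <= n -> a < m -> a < i <= skip a ->
  conn_at a S -> head 0 S < i ->
  (forall j, i <= j < skip a -> par j < i -> par j \in S) ->
  inner a S sp D 1 h -> var h vi = i ->
  (forall b S', a < b -> conn_at b S' -> head 0 S' < m -> solved (arr h TAB) S') ->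
  (forall S', conn_at a S' -> head 0 S' < m ->
     {subset filter (gtn i) S' <= S} -> filter (gtn i) S' <> S ->
     solved (arr h TAB) S') ->
  reach inp $vrun enum_step h (enum_time i (skip a)) (fun h' =>
    [/\ inner a S sp D 0 h', grows h h' &
        forall S', conn_at a S' -> head 0 S' < m -> filter (gtn i) S' = S ->
          solved (arr h' TAB) S']).
Proof.
elim: n i S sp D h => [|n IHn] i S sp D h ni am /andP[ai ie] cS hi el inn vi_i Hb Hs;
  have [i_end|lt] : i = skip a \/ i < skip a by [lia|lia].
- by rewrite i_end in vi_i hi Hs *; apply: enum_last.
- lia.
- by rewrite i_end in vi_i hi Hs *; apply: enum_last.
have em := skip_le am; have im : i < m by apply: leq_trans lt em.
have pi : par i < i by apply: par_lt; lia.
have pS : par i \in S by apply: el => //; rewrite leqnn.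
have si := skip_gt im.
have sie : skip i <= skip a by apply: skip_nest => //; rewrite lt ltnW.
have iS : i \notin S by apply/negP=> /(conn_at_le_head cS); lia.
have ciS : conn_at a (i :: S) by rewrite conn_at_cons ?hi.
have Slt z : z \in S -> z < i by move/(conn_at_le_head cS); lia.
apply: reach_weaken (enum_time_rec lt em sie) _; last by move=> h'; apply.
apply: reach_trans (reach_step _ (exclude_ok inn vi_i lt)) _.
  by rewrite /= (inner_run inn).
move=> h1 [inn1 vi1 t1].
apply: reach_trans.
  apply: (IHn (skip i) S sp.+1 (update D sp i) h1) => //.
  - lia.
  - by rewrite sie andbT; lia.
  - lia.
  - move=> j /andP[ij ja] pj; apply: el; first lia.
    have := @skipP i j; rewrite (leq_trans si ij) (leq_trans ja em) => /(_ isT).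
    by rewrite ltnNge ij pj andbT => /esym/negbT; rewrite -ltnNge.
  - by rewrite t1.
  - move=> S' cS' hm' sub ne; rewrite t1.
    have E : filter (gtn i) S' = filter (gtn (skip i)) S'.
      apply: eq_in_filter => z zS /=.
      case: (ltnP z (skip i)) => zs; last by apply/negP; lia.
      by apply: Slt; apply: sub; rewrite mem_filter /= zs.
    by apply: Hs => //; rewrite E.
move=> h2 [inn2 gr2 ex2].
have D1 : update D sp i sp = i by rewrite /update eqxx.
apply: reach_trans (reach_step _ (include_ok ai im cS hi pS inn2 D1)) _.
  by rewrite /= (inner_run inn2).
move=> h3 [inn3 vi3 t3].
have out S' : conn_at a S' -> head 0 S' < m -> i \notin S' ->
    filter (gtn i) S' = S -> solved (arr h2 TAB) S'.
  by move=> cS' hm' iS' E; apply: ex2 => //; rewrite (filter_gtn_skip cS').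
apply: reach_trans.
  apply: (IHn i.+1 (i :: S) sp.+1 (update D sp i) h3) => //.
  - lia.
  - lia.
  - move=> j /andP[ij ja]; rewrite inE ltnS leq_eqVlt => /orP[->//|pj].
    by rewrite el ?orbT //; lia.
  - move=> b S' ab cS' hm'; rewrite t3; apply: (gr2 _ _ cS' hm').
    by rewrite t1; apply: Hb ab cS' hm'.
  - move=> S' cS' hm'; rewrite t3 (filter_gtnS i (conn_at_sorted cS')) => sub ne.
    have sub' : {subset filter (gtn i) S' <= S}.
      move=> z zF; have zi : z < i by move: zF; rewrite mem_filter => /andP[].
      have : z \in i :: S by apply: sub; case: ifP => _ //; rewrite inE zF orbT.
      by rewrite inE (ltn_eqF zi).
    (* A set containing [i] has a proper subset of [S] before [i], hence was solved at the outset. A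
       set without [i] was solved either at the outset or by the branch that excludes [i]. *)
    case: ifP sub ne => [iS' _ ne|/negbT iS' _ _].
      apply: (gr2 _ _ cS' hm'); rewrite t1; apply: Hs => // E; apply: ne; by rewrite E.
    case: (filter (gtn i) S' =P S) => [E|ne]; first exact: out.
    by apply: (gr2 _ _ cS' hm'); rewrite t1; apply: Hs.
move=> h4 [inn4 gr4 in4].
apply: reach_weaken (reach_step _ (exclude_again iS cS ciS im D1 inn4)) _ _ => //.
  by rewrite /= (inner_run inn4).
move=> h5 [inn5 t5].
have gr24 : grows h2 h4 by move=> b S' cS' hm' sv; apply: (gr4 _ _ cS' hm'); rewrite t3.
split.
- case: inn5 => ? ? ? ? ? ? ? ? ? ? dec5; split=> // j js.
  by rewrite dec5 // /update; case: eqP => //; lia.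
- move=> b S' cS' hm' sv; rewrite t5; apply: (gr24 _ _ cS' hm').
  by apply: (gr2 _ _ cS' hm'); rewrite t1.
- move=> S' cS' hm' E; rewrite t5.
  case: (boolP (i \in S')) => iS'; last by apply: (gr24 _ _ cS' hm'); apply: out.
  by apply: in4 => //; rewrite (filter_gtnS i (conn_at_sorted cS')) iS' E.
Qed.

(** The base is [m] rather than [m.+1], because the top itself is not decided. *)
Lemma enum_time_le a : a < m ->
  enum_time a.+1 (skip a) <= (solve_time + 124) * m ^ nleaves 0 m.
Proof.
move=> am; have sa := skip_gt am; have sm := skip_le am.
apply: leq_trans (leq_subr _ _) _; rewrite leq_mul2l; apply/orP; right.
apply: (@leq_trans (m ^ nleaves a.+1 (skip a))).
  by apply: leq_expn2r; lia.
apply: leq_pexp2l; first lia.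
rewrite (@nleaves_add 0 (skip a) m) ?sm // (@nleaves_add 0 a.+1 (skip a)) ?sa //.
by rewrite -addnA addnCA leq_addr.
Qed.

Lemma enum_prog_ok a h : a < m -> static h -> var h va = a ->
  (forall b S, a < b -> conn_at b S -> head 0 S < m -> solved (arr h TAB) S) ->
  runs inp enumerate h ((solve_time + 124) * m ^ nleaves 0 m + 100) (fun h' =>
    [/\ static h', var h' va = a & forall b S, a <= b -> conn_at b S ->
         head 0 S < m -> solved (arr h' TAB) S]).
Proof.
move=> am st ha Hb; have sa := skip_gt am.
apply: (@runs_le _ _ _ (1 + (1 + (1 + (1 + (1 + (1 + (1 + (1 + (1 +
  (enum_time a.+1 (skip a) + (40 + 1).+1))))))))))); last by have := enum_time_le am; lia.
do 9 (apply: runs_seq_run => //).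
set h1 := (X in runs _ _ X).
have [s1 s2 s3 s4 s5 s6] := st.
have inn : inner a [:: a] 0 id 1 h1.
  split=> //; rewrite /h1 /= /update /= ?ha ?s4 ?s6 ?eqxx //.
    by rewrite /key big_seq1.
  by rewrite /kids /= eqxx.
have vi1 : var h1 vi = a.+1 by rewrite /h1 /= /update /= ha addn1.
have t1 : arr h1 TAB = arr h TAB by rewrite /h1.
clearbody h1.
(* Since all sets with top [a] agree before [a.+1], the condition on sets solved earlier is vacuous
   and the conclusion of [enum_ok] covers all of them. *)
have F S : conn_at a S -> filter (gtn a.+1) S = [:: a].
  move=> cS; rewrite (filter_gtnS a (conn_at_sorted cS)) (conn_at_last cS).
  rewrite (_ : filter (gtn a) S = [::]) //; apply/eqP; rewrite -[_ == _]negbK -has_filter.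
  by apply/hasP=> -[z /(conn_at_ge cS)] /=; lia.
apply: (@enum_ok (skip a) a a.+1 [:: a] 0 id h1) => //.
- lia.
- by rewrite ltnSn.
- exact: eqxx.
- move=> j /andP[aj ja] pj; have sm := skip_le am.
  have := @skipP a j; rewrite aj (leq_trans ja sm) ja => /(_ isT)/esym/andP[ap _].
  by rewrite inE eqn_leq ap andbT.
- by rewrite t1.
- by move=> S' cS' _ _; rewrite F.
move=> h' [inn' gr sv].
apply: (@runs_while_true _ _ _ _ 40 1 (fun h2 => [/\ static h2, var h2 va = a,
    var h2 vrun = 0 & arr h2 TAB = arr h' TAB])).
- by rewrite /= (inner_run inn').
- rewrite -[40]/39.+1; apply: runs_if => [|_]; first by rewrite /= (inner_down inn').
  rewrite -[39]/38.+1; apply: runs_if => [|_]; first by rewrite /= (inner_sp inn').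
  apply: runs_run => //; split=> //; last by rewrite /= /update /= (inner_a inn').
  by case: (inner_static inn') => *; split.
move=> h2 [st2 a2 r2 t2]; apply: runs_while_false => //; split=> // b S ab cS hm.
rewrite t2; move: ab; rewrite leq_eqVlt => /orP[/eqP E|ab].
  by move: cS; rewrite -E => cS; apply: sv => //; apply: F.
by apply: (gr _ _ cS hm); rewrite t1; apply: Hb ab cS hm.
Qed.

(** * All tops *)

Definition full_set := rev (iota 0 m).

Lemma rev_iotaS n : rev (iota 0 n.+1) = n :: rev (iota 0 n).
Proof. by rewrite -addn1 iotaD rev_cat add0n. Qed.

Lemma full_conn_at : 0 < m -> conn_at 0 full_set.
Proof.
rewrite /full_set; case: (m) => // n _; elim: n => [|n IHn]; first by [].
rewrite rev_iotaS conn_at_cons //; apply/andP; split; first by rewrite rev_iotaS.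
by rewrite mem_rev mem_iota /= par_lt.
Qed.

(** [vwt] ends as the weight of a fictitious vertex [m], one more than the address of the optimum
    for the full set. *)
Lemma key_full : key full_set + m = m.+1 * 2 ^ m - 1.
Proof.
rewrite /key /full_set -big_distrr /=.
have H n : \sum_(i <- rev (iota 0 n)) 2 ^ i = 2 ^ n - 1.
  elim: n => [|n IHn]; first by rewrite big_nil.
  by rewrite rev_iotaS big_cons IHn expnS; have := expn_gt0 2 n; lia.
rewrite H mulnBr muln1; have : m.+1 <= m.+1 * 2 ^ m by rewrite leq_pmulr ?expn_gt0.
lia.
Qed.

Lemma solve_all_ok h : 0 < m -> static h ->
  runs inp solve_all h (m * ((solve_time + 124) * m ^ nleaves 0 m + 102) + 3)
    (fun h' => is_opt full_set (var h' vm)).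
Proof.
move=> m0 st; have [s1 s2 s3 s4 s5 s6] := st.
set C := (solve_time + 124) * m ^ nleaves 0 m + 100.
apply: (@runs_le _ _ _ (1 + ((m * (1 + C).+1).+1 + 1))); last by rewrite /C; lia.
apply: runs_seq_run => //.
pose I h := [/\ static h, var h va <= m & forall b S, var h va <= b -> conn_at b S ->
  head 0 S < m -> solved (arr h TAB) S].
have := @runs_while inp $va (va ::= $va -' #1;; enumerate) I (fun h => var h va) (1 + C)
  (set_var h va m) m.
case=> [h1 [st1 am Hb] a0| | |t [h' [ht le inv]]].
- have a_lt : (var h1 va).-1 < m by move: a0 => /=; lia.
  apply: (runs_seq_run (T := C)) => //; set h1' := run _ _ _.
  have st1' : static h1' by case: st1 => *; split.
  have a1' : var h1' va = (var h1 va).-1 by rewrite /h1' /= /update /= subn1.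
  have Hb' b S : (var h1 va).-1 < b -> conn_at b S -> head 0 S < m ->
      solved (arr h1' TAB) S.
    by move=> ab; apply: Hb; lia.
  apply: runs_weaken (enum_prog_ok a_lt st1' a1' Hb') _ _ => // h2 [st2 a2 sv2].
  split; last by rewrite a2; move: a0 => /=; lia.
  by split=> //; rewrite a2 //; lia.
- split; [by split|by rewrite /= /update|].
  (* The invariant starts out vacuous, as no top is as large as [m]. *)
  move=> b S; rewrite /= /update /= => mb cS hm; have := conn_at_ge cS.
  case: S cS hm => // x S cS /= xm H; have := H x (mem_head _ _); lia.
- by rewrite /= /update.
apply: (@runs_seq _ _ _ _ _ _ (fun h' => I h' /\ eval inp h' $va = 0)).
  by exists t, h'; split=> //; rewrite /= s1.

move=> h2 [[st2 _ Hb2] a2]; apply: runs_run => //=.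
have le0 : var h2 va <= 0 by rewrite (a2 : var h2 va = 0).
have hf : head 0 full_set < m.
  by rewrite /full_set; case: (m) m0 => // n _; rewrite rev_iotaS /=.
have [so _] := Hb2 _ _ le0 (full_conn_at m0) hf.
by rewrite /update /= (static_wt st2) -key_full.
Qed.

End RootedTree.

(** * Trees as graphs *)

Lemma nth_flatten_const (T : Type) (x0 : T) m (ss : seq (seq T)) i j :
  all (fun s => size s == m) ss -> i < size ss -> j < m ->
  nth x0 (flatten ss) (i * m + j) = nth x0 (nth [::] ss i) j.
Proof.
elim: ss i => // s ss IHss [|i] /= /andP[/eqP sm sss]; rewrite nth_cat sm => si jm.
  by rewrite jm.
by rewrite ltnNge mulSn -addnA leq_addr /= addKn IHss.
Qed.

Lemma input_edge m (e : rel 'I_m) (v : ranking m) (i j : 'I_m) :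
  nth 0 (input_words e v) (i * m + j) = e i j.
Proof.
rewrite nth_cat size_allpairs size_enum_ord.
have -> : i * m + j < m * m.
  by apply: (@leq_trans (i.+1 * m)); rewrite ?leq_mul // mulSn addnC ltn_add2r.
rewrite /allpairs_dep nth_flatten_const ?size_map ?size_enum_ord //.
  by rewrite (nth_map i) ?size_enum_ord // nth_ord_enum (nth_map j) ?size_enum_ord // nth_ord_enum.
by apply/allP=> s /mapP[x _ ->]; rewrite size_map size_enum_ord.
by rewrite -enumT size_enum_ord.
Qed.

Lemma input_rank m (e : rel 'I_m) (v : ranking m) (t : 'I_m) :
  nth 0 (input_words e v) (m * m + t) = (v^-1)%g t.
Proof.
rewrite nth_cat size_allpairs size_enum_ord ltnNge leq_addr /= addKn.
by rewrite (nth_map t) ?size_enum_ord // nth_ord_enum.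
Qed.

Section Graph.

Variables (m : nat) (e : rel 'I_m).
Hypothesis tree : is_tree e.

Let e_sym : symmetric e. Proof. by case: tree => -[]. Qed.
Let e_irr : irreflexive e. Proof. by case: tree => -[]. Qed.
Let e_acyclic : acyclic e. Proof. by case: tree. Qed.

Lemma tree_gt0 : 0 < m.
Proof.
case: tree => _ /andP[/set0Pn[x _] _] _; exact: leq_ltn_trans (leq0n x) (ltn_ord x).
Qed.

Lemma tree_connect x y : connect e x y.
Proof.
case: tree => _ /andP[_ /forall_inP H] _.
have /forall_inP/(_ y (in_setT _)) := H x (in_setT _).
by apply: connect_sub => a b /and3P[_ _ ab]; apply: connect1.
Qed.

Lemma tree_closed (A : 'I_m -> Prop) x : A x -> (forall a b, A a -> e a b -> A b) ->
  forall y, A y.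
Proof.
move=> Ax H y; have [p] := connectP (tree_connect x y).
elim: p x Ax => [|z p IHp] x Ax /=; first by move=> _ ->.
by case/andP=> xz; apply: IHp; apply: H xz.
Qed.

(** A simple path of [te] from [x] to [y] with an inner vertex would close to a cycle with the edge
    [x y]. *)
Lemma spanning_edge (te : rel 'I_m) x y : subrel te e -> connect te x y ->
  e x y -> te x y.
Proof.
move=> te_e /connectP[p0 p0p ->] {y}.
case/shortenP: p0p => p pp up _; case: p pp up => [|y [|z p]] /=.
- by rewrite e_irr.
- by rewrite andbT.
move=> /and3P[xy yz zp] up exl; exfalso.
have /negP := @e_acyclic [:: x, y, z & p] isT; apply; rewrite /ucycleb /= rcons_path.
rewrite (te_e _ _ xy) (te_e _ _ yz) /= (sub_path te_e zp) up /= andbT.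
by rewrite e_sym.
Qed.

(** If all degrees were at least 2, every simple path could be prolonged at its start: a neighbour
    of [x] other than the second vertex that recurs on the path would close a cycle. Some simple
    path would then have more than [m] vertices. *)
Lemma tree_leaf : exists x, degree e x <= 1.
Proof.
case: (pickP (fun x => degree e x <= 1)) => [x|H]; first by exists x.
have ext x y : exists2 z, e x z & z != y.
  have : 0 < #|[set z | e x z] :\ y|.
    by have := H x => /=; rewrite /degree (cardsD1 y); case: (_ \in _) => /=; lia.
  by case/card_gt0P=> z; rewrite !inE => /andP[zy xz]; exists z.
have x0 := Ordinal tree_gt0.
have long k : exists x p, [/\ path e x p, uniq (x :: p) & size p = k].
  elim: k => [|k [x [p [pp up sp]]]]; first by exists x0, [::].
  (* For an empty [p] the default of [head] is [x], so any neighbour will do. *)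
  have [z xz zp] := ext x (head x p).
  have zx : z != x by apply/eqP=> E; rewrite E e_irr in xz.
  case: (boolP (z \in p)) => [zin|znot]; last first.
    exists z, (x :: p); split; rewrite /= ?sp //; first by rewrite e_sym xz.
    by rewrite inE negb_or zx znot.
  exfalso; case/splitPr: zin pp up zp {sp} => p1 p2 pp up zp.
  have sz : 2 < size (x :: rcons p1 z).
    by case: p1 {pp up} zp => [|a p1]; rewrite /= ?size_rcons // eqxx.
  have /negP := e_acyclic sz; apply.
  move: pp up; rewrite -cat_rcons cat_path -cat_cons cat_uniq => /andP[pp _] /andP[up _].
  by rewrite /ucycleb up /= rcons_path pp last_rcons e_sym xz.
have [x [p [_ up sp]]] := long m.
have := card_uniqP up; have := max_card (mem (x :: p)).
by rewrite card_ord /= sp => l E; rewrite E in l; lia.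
Qed.

End Graph.

(** * Correctness of the depth-first numbering *)

Section Numbering.

Variables (m : nat) (inp : nat -> nat).
Hypothesis m_gt0 : 0 < m.

Definition adj x y := inp (x * m + y) != 0.

(* [SKIP i] is 0 as long as [i] is on the path from the root to [vu]. *)
Record dfs_inv root rank (h : env) : Prop := DfsInv {
  dfs_m : var h vm = m;
  dfs_row : forall i, i < m -> arr h ROW i = i * m;
  dfs_rank : arr h RANK = rank;
  dfs_u : var h vu < var h vcnt;
  dfs_cnt : var h vcnt <= m;
  dfs_lab : forall i, i < var h vcnt -> arr h LAB i < m;
  dfs_inj : forall i j, i < var h vcnt -> j < var h vcnt ->
    arr h LAB i = arr h LAB j -> i = j;
  dfs_root : arr h LAB 0 = root;
  dfs_vis : forall w, arr h VIS w != 0 <-> exists2 i, i < var h vcnt & arr h LAB i = w;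
  dfs_par : forall i, 0 < i < var h vcnt ->
    arr h PAR i < i /\ adj (arr h LAB (arr h PAR i)) (arr h LAB i);
  dfs_par0 : forall i, var h vcnt <= i -> arr h PAR i = 0;
  dfs_scan : forall i, i < var h vcnt -> arr h SCAN i <= m /\
    forall w, w < arr h SCAN i -> adj (arr h LAB i) w -> arr h VIS w != 0;
  dfs_new : forall i, var h vcnt <= i -> arr h SCAN i = 0 /\ arr h SKIP i = 0;
  dfs_done : forall i, i < var h vcnt -> arr h SKIP i != 0 ->
    [/\ arr h SCAN i = m, i < arr h SKIP i <= var h vcnt
      & forall j, i < j < var h vcnt ->
          (j < arr h SKIP i) = (i <= arr h PAR j < arr h SKIP i)];
  dfs_active : forall i, i < var h vcnt -> arr h SKIP i = 0 ->
    [/\ i <= var h vu, forall j, i < j < var h vcnt -> i <= arr h PAR j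
      & 0 < i -> arr h SKIP (arr h PAR i) = 0 /\
          forall j, arr h PAR i < j < i -> arr h SKIP j != 0];
  dfs_run : if var h vrun == 0 then
              forall i, i < var h vcnt -> arr h SKIP i != 0
            else arr h SKIP (var h vu) = 0 }.

(** Each step advances the scan of the current vertex or closes it. *)
Definition dfs_left (h : env) :=
  \sum_(i < m) ((m - arr h SCAN i) + (arr h SKIP i == 0)).

Lemma sum_decr (f g : nat -> nat) u : u < m -> (forall i, i != u -> f i = g i) ->
  f u < g u -> \sum_(i < m) f i < \sum_(i < m) g i.
Proof.
move=> um E lt; rewrite (bigD1 (Ordinal um)) //= [X in _ < X](bigD1 (Ordinal um)) //=.
by rewrite (eq_bigr (fun i : 'I_m => g i)) => [|i ne]; [rewrite ltn_add2r|exact: E].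
Qed.

(** The parent of an open vertex is open, so climbing from [x] inside the closed interval would
    arrive at [i], which is closed. *)
Lemma dfs_active_done root rank h i x : dfs_inv root rank h ->
  x < var h vcnt -> arr h SKIP x = 0 -> arr h SKIP i != 0 -> ~~ (i < x < arr h SKIP i).
Proof.
move=> inv; have [n] := ubnP x; elim: n x => // n IHn x xn xc x0 i0.
apply/negP=> /andP[ix xi]; have ic := ltn_trans ix xc.
have [_ _ D] := dfs_done inv ic i0; have [_ _ A] := dfs_active inv xc x0.
have [p0 _] := A (leq_ltn_trans (leq0n i) ix).
have := D x; rewrite ix xc xi => /(_ isT)/esym/andP[ip pi].
have xx : 0 < x < var h vcnt by rewrite xc (leq_ltn_trans (leq0n i) ix).
have [px _] := dfs_par inv xx.
have ne : i != arr h PAR x by apply: contraNneq i0 => ->; rewrite p0.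
have /negP := IHn (arr h PAR x) (leq_trans px xn) (ltn_trans px xc) p0 i0; apply.
by rewrite ltn_neqAle ne ip.
Qed.

Lemma dfs_step_ok root rank h : dfs_inv root rank h -> var h vrun != 0 ->
  let h' := run inp dfs_step h in dfs_inv root rank h' /\ dfs_left h' < dfs_left h.
Proof.
move=> inv r0; have := dfs_run inv; rewrite (negPf r0) => skip_u.
have uc := dfs_u inv; have cm := dfs_cnt inv.
have um : var h vu < m := leq_trans uc cm.
set u := var h vu in skip_u uc um; set c := var h vcnt in uc cm.
have [sm su] := dfs_scan inv uc.
case: (ltnP (arr h SCAN u) m) => [sc|sc].
  set w := arr h SCAN u in sm su sc.
  have row : arr h ROW (arr h LAB u) = arr h LAB u * m.
    by apply: (dfs_row inv); apply: (dfs_lab inv).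
  set h1 := set_arr (set_var h vw w) SCAN u w.+1.
  have -> : run inp dfs_step h =
      if adj (arr h LAB u) w && (arr h VIS w == 0) then
        set_var (set_var (set_arr (set_arr (set_arr h1 VIS w 1) LAB c w) PAR c u)
          vu c) vcnt c.+1
      else h1.
    rewrite /h1 /= /set_var /set_arr /update /= (dfs_m inv) -/u -/w -/c.
    rewrite subn_eq0 leqNgt sc /= row -/(adj _ _) !addn1 /adj.
    by case: (inp _ == 0) => //=; case: (arr h VIS w == 0).
  case: ifP => [/andP[aw /eqP vw]|aw] h'.
    have w_new i : i < c -> arr h LAB i != w.
      move=> ic; apply/eqP=> E; have /(dfs_vis inv) : exists2 i, i < c & arr h LAB i = w.
        by exists i.
      by rewrite vw.
    (* [w] and the [c] labels in use are distinct numbers below [m]. *)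
    have c_lt : c < m.
      have un : uniq (w :: map (arr h LAB) (iota 0 c)).
        rewrite /= map_inj_in_uniq ?iota_uniq ?andbT.
          apply/mapP=> -[i]; rewrite mem_iota add0n => /andP[_ ic] E.
          by have := w_new i ic; rewrite -E eqxx.
        move=> i j; rewrite !mem_iota !add0n => /andP[_ ic] /andP[_ jc].
        exact: (dfs_inj inv).
      have := uniq_leq_size (s2 := iota 0 m) un; rewrite /= size_map !size_iota; apply.
      move=> i; rewrite inE mem_iota add0n => /orP[/eqP->//|/mapP[j]].
      by rewrite mem_iota add0n => /andP[_ jc] ->; apply: (dfs_lab inv).
    have [c_scan c_skip] := dfs_new inv (leqnn c).
    have c_pos : 0 < c by apply: leq_ltn_trans (leq0n u) uc.
    have upd f x i : i < c -> update f c x i = f i.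
      by rewrite /update; case: eqP => // ->; rewrite ltnn.
    have upc f x : update f c x c = x by rewrite /update eqxx.
    have usc i : i != u -> update (arr h SCAN) u w.+1 i = arr h SCAN i.
      by rewrite /update => /negPf ->.
    have vis_le x : arr h VIS x != 0 -> update (arr h VIS) w 1 x != 0.
      by rewrite /update; case: (x == w).
    split; last first.
      apply: (@sum_decr (fun i => m - update (arr h SCAN) u w.+1 i + (arr h SKIP i == 0))
        (fun i => m - arr h SCAN i + (arr h SKIP i == 0)) u) => // [i ne|].
        by rewrite usc.
      by rewrite /update eqxx ltn_add2r ltn_sub2l.
    split; rewrite -?[var h' vcnt]/c.+1 -?[var h' vu]/c -?[arr h' LAB]/(update (arr h LAB) c w)
      -?[arr h' PAR]/(update (arr h PAR) c u) -?[arr h' SCAN]/(update (arr h SCAN) u w.+1)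
      -?[arr h' VIS]/(update (arr h VIS) w 1) -?[arr h' SKIP]/(arr h SKIP) //.
    - exact: dfs_m inv.
    - exact: dfs_row inv.
    - exact: dfs_rank inv.
    - move=> i; rewrite ltnS leq_eqVlt => /orP[/eqP->|ic]; rewrite ?upc ?upd //.
      exact: (dfs_lab inv).
    - move=> i j; rewrite !ltnS leq_eqVlt => /orP[/eqP->|ic];
        rewrite leq_eqVlt => /orP[/eqP->|jc] //; rewrite ?upc ?upd //.
      + by move=> E; have := w_new j jc; rewrite -E eqxx.
      + by move=> E; have := w_new i ic; rewrite E eqxx.
      + exact: (dfs_inj inv).
    - by rewrite upd //; exact: dfs_root inv.
    - move=> x; split=> [|[i]].
        rewrite /update; case: (x =P w) => [-> _|_ /(dfs_vis inv)[i ic <-]].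
          by exists c; rewrite ?eqxx.
        by exists i; [apply: leq_trans ic _|rewrite ltn_eqF].
      rewrite ltnS leq_eqVlt => /orP[/eqP->|ic]; rewrite ?upc ?upd // => <-.
        by rewrite /update eqxx.
      by apply: vis_le; apply/(dfs_vis inv); exists i.
    - move=> i /andP[i0]; rewrite ltnS leq_eqVlt => /orP[/eqP->|ic].
        by rewrite !upc upd.
      have ii : 0 < i < c by rewrite i0.
      have [pi ei] := dfs_par inv ii.
      by rewrite !upd //; apply: ltn_trans pi ic.
    - move=> i ci; rewrite /update gtn_eqF //; apply: (dfs_par0 inv); exact: ltnW.
    - move=> i; rewrite ltnS leq_eqVlt => /orP[/eqP->|ic].
        by rewrite usc ?c_scan ?gtn_eqF.
      rewrite upd //; case: (eqVneq i u) => [->|ne].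
        split=> [|x]; rewrite /update eqxx // ltnS leq_eqVlt => /orP[/eqP->|xw ax].
          by rewrite eqxx.
        by apply: vis_le; apply: su ax.
      rewrite usc //; have [si sx] := dfs_scan inv ic; split=> // x xs ax.
      by apply: vis_le; apply: sx ax.
    - move=> i ci; rewrite usc ?gtn_eqF //; last exact: ltn_trans uc ci.
      by apply: (dfs_new inv); apply: ltnW.
    - move=> i; rewrite ltnS leq_eqVlt => /orP[/eqP->|ic] ski; first by rewrite c_skip in ski.
      have [s1 /andP[s2 s3] s4] := dfs_done inv ic ski.
      have ne : i != u by apply: contraNneq ski => ->; rewrite skip_u.
      split; [by rewrite usc|by rewrite s2 leqW|].
      move=> j /andP[ij]; rewrite ltnS leq_eqVlt => /orP[/eqP->|jc]; last first.
        by rewrite upd // s4 // ij.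
      (* The new vertex lies beyond every closed interval, and its parent [u], being open, lies in
         none. *)
      rewrite upc ltnNge s3 /=; apply/esym; rewrite leq_eqVlt (negPf ne) /=.
      exact: negbTE (dfs_active_done inv uc skip_u ski).
    - move=> i; rewrite ltnS leq_eqVlt => /orP[/eqP->|ic] ski.
        rewrite eqxx; split=> // [j /andP[cj]|_]; first by rewrite ltnS leqNgt cj.
        rewrite upc skip_u; split=> // j /andP[uj jc]; apply/eqP=> j0.
        by have [] := dfs_active inv jc j0; rewrite -/u leqNgt uj.
      have [s1 s2 s3] := dfs_active inv ic ski; split=> [|j|i0].
      + by rewrite ic orbT.
      + rewrite ltnS => /andP[ij]; rewrite leq_eqVlt => /orP[/eqP->|jc].
          by rewrite upc.
        by rewrite upd // s2 // ij.
      + by rewrite upd //; apply: s3.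
    - by rewrite -[var h' vrun]/(var h vrun) (negPf r0).
  have usc i : i != u -> update (arr h SCAN) u w.+1 i = arr h SCAN i.
    by rewrite /update => /negPf ->.
  split; last first.
    apply: (@sum_decr (fun i => m - update (arr h SCAN) u w.+1 i + (arr h SKIP i == 0))
      (fun i => m - arr h SCAN i + (arr h SKIP i == 0)) u) => // [i ne|].
      by rewrite usc.
    by rewrite /update eqxx ltn_add2r ltn_sub2l.
  case: (inv) => i1 i2 i3 i4 i5 i6 i7 i8 i9 i10 i11 i12 i13 i14 i15 i16.
  split=> //; rewrite -?[arr h' SCAN]/(update (arr h SCAN) u w.+1).
  - move=> i ic; case: (eqVneq i u) => [->|ne]; last by rewrite usc //; apply: i12.
    split=> [|x]; rewrite /update eqxx // ltnS leq_eqVlt => /orP[/eqP->|xw ax].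
      by move=> aw'; move: aw; rewrite aw' /= => /negbT.
    by apply: su ax.
  - move=> i ci; rewrite usc ?gtn_eqF //; last exact: leq_trans uc ci.
    exact: i13.
  - move=> i ic ski; have ne : i != u by apply: contraNneq ski => ->; apply/eqP/skip_u.
    by rewrite usc //; apply: i14.
set p := arr h PAR u.
have -> : run inp dfs_step h =
    let h1 := set_arr (set_var h vw (arr h SCAN u)) SKIP u c in
    if u == 0 then set_var h1 vrun 0 else set_var h1 vu p.
  rewrite /= /set_var /set_arr /update /= (dfs_m inv) -/u -/c -/p.
  by move/eqP: sc; rewrite -/u => ->.
have c0 : c != 0 by rewrite -lt0n (leq_ltn_trans (leq0n u) uc).
have usk i : i != u -> update (arr h SKIP) u c i = arr h SKIP i.
  by rewrite /update => /negPf ->.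
have uskip : update (arr h SKIP) u c u = c by rewrite /update eqxx.
have skip_le i : arr h SKIP i != 0 -> update (arr h SKIP) u c i != 0.
  by rewrite /update; case: (i == u).
have [_ ua1 ua2] := dfs_active inv uc skip_u.
case: (inv) => i1 i2 i3 i4 i5 i6 i7 i8 i9 i10 i11 i12 i13 i14 i15 i16.
have decr : \sum_(i < m) (m - arr h SCAN i + (update (arr h SKIP) u c i == 0)) < dfs_left h.
  apply: (@sum_decr (fun i => m - arr h SCAN i + (update (arr h SKIP) u c i == 0))
    (fun i => m - arr h SCAN i + (arr h SKIP i == 0)) u) => // [i ne|].
    by rewrite usk.
  by rewrite uskip skip_u (negPf c0) ltn_add2l.
have new i : c <= i -> arr h SCAN i = 0 /\ update (arr h SKIP) u c i = 0.
  move=> ci; rewrite usk; first exact: i13.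
  by rewrite gtn_eqF // (leq_trans uc ci).
have done_ok i : i < c -> update (arr h SKIP) u c i != 0 ->
    [/\ arr h SCAN i = m, i < update (arr h SKIP) u c i <= c
      & forall j, i < j < c -> (j < update (arr h SKIP) u c i) =
          (i <= arr h PAR j < update (arr h SKIP) u c i)].
  move=> ic; case: (eqVneq i u) => [->|ne]; last by rewrite usk //; apply: i14.
  rewrite uskip => _; split; [|by rewrite uc leqnn|].
    by apply/eqP; rewrite eqn_leq sm.
  (* As [u] is open, all vertices numbered after it have parents from [u] on. So at closing time the
     interval from [u] to [c] is exactly the subtree of [u]. *)
  move=> j /andP[uj jc]; rewrite jc ua1 ?uj //=; apply/esym.
  have jj : 0 < j < c by rewrite (leq_ltn_trans (leq0n u) uj).
  by have [pj _] := i10 _ jj; apply: ltn_trans pj jc.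
have act i : i < c -> update (arr h SKIP) u c i = 0 -> i != u /\ arr h SKIP i = 0.
  move=> ic; case: (eqVneq i u) => [->|ne]; last by rewrite usk.
  by rewrite uskip => E; rewrite E in c0.
case: (posnP u) => [u0|u_gt0] /=.
  split=> //; split=> //=.
  - move=> i ic si; have [ne s0] := act i ic si; have [] := i15 i ic s0.
    by rewrite -/u u0 leqn0 => /eqP E; rewrite E u0 in ne.
  - move=> i ic; case: (eqVneq i u) => [->|ne]; first by rewrite uskip.
    rewrite usk //; apply/eqP=> s0; have [] := i15 i ic s0.
    by rewrite -/u u0 leqn0 => /eqP E; rewrite E u0 in ne.
have [p0 pbetween] := ua2 u_gt0.
have uu : 0 < u < c by rewrite u_gt0.
have [pu _] := i10 _ uu.
split=> //; split=> //=.
- exact: ltn_trans pu uc.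
- move=> i ic si; have [ne s0] := act i ic si; have [a1 a2 a3] := i15 i ic s0.
  have iu : i < u by rewrite ltn_neqAle ne.
  (* The vertices strictly between the parent [p] and [u] are closed, so an open one before [u] is
     at most [p]. *)
  have ip : i <= p.
    rewrite leqNgt; apply/negP=> pi; have := pbetween i; rewrite pi iu => /(_ isT).
    by rewrite s0.
  split=> // i0; have [a4 a5] := a3 i0; have ii : 0 < i < c by rewrite i0.
  have [pi _] := i10 _ ii; split=> [|j jj]; last exact: skip_le (a5 j jj).
  by rewrite usk // ltn_eqF // (ltn_trans pi iu).
- have : update (arr h SKIP) u c p = 0 by rewrite usk // ltn_eqF.
  by rewrite /update /= (negPf r0).
Qed.

(** * The phases around the depth-first search *)

Lemma number_ok h : var h vm = m -> var h vacc = 0 ->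
  (forall t i, arr h t i = 0) ->
  (forall t t', t < m -> t' < m -> inp (m * m + t) = inp (m * m + t') -> t = t') ->
  runs inp number h (12 * m + 10) (fun h' => [/\ var h' vm = m,
    forall i, i < m -> arr h' ROW i = i * m,
    forall t, t < m -> arr h' RANK (inp (m * m + t)) = t
    & forall t i, RANK < t -> arr h' t i = 0]).
Proof.
move=> hm ha hz inj.
apply: (@runs_le _ _ _ (1 + ((m * 6).+1 + (1 + (m * 4).+1)))); last by lia.
apply: runs_seq_run => //; set h1 := run _ _ _.
apply: runs_seq.
  apply: (@runs_while _ _ _ (fun h => [/\ var h vm = m, var h vi <= m,
    var h vacc = var h vi * m, forall i, i < var h vi -> arr h ROW i = i * m
    & forall t i, ROW < t -> arr h t i = 0]) (fun h => m - var h vi)).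
  - move=> h2 [bm bi ba br bz] /= c; apply: runs_run => //.
    have lt : var h2 vi < m by lia.
    split; last by rewrite /= /update /=; lia.
    split=> [//||||t i Ht]; rewrite /= /update /= ?bm ?ba.
    + by rewrite addn1.
    + by rewrite addn1 mulSn addnC.
    + move=> i; rewrite addn1 ltnS leq_eqVlt; case: eqP => [->//|_] /=; exact: br.
    + by case: t Ht => // t _; apply: bz.
  - by split=> //; rewrite /h1 /= /update /= ?hm ?ha.
  - by rewrite leq_subr.
move=> h2 [[bm bi ba br bz] c].
have {}ba : var h2 vacc = m * m by rewrite ba; congr (_ * _); move: c => /=; lia.
have {}br i : i < m -> arr h2 ROW i = i * m by move=> im; apply: br; move: c => /=; lia.
apply: runs_seq_run => //; set h3 := run _ _ _.
apply: runs_weaken; first apply: (@runs_while _ _ _ (fun h => [/\ var h vm = m,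
    var h vi <= m, var h vacc = m * m, arr h ROW = arr h2 ROW
    & (forall t, t < var h vi -> arr h RANK (inp (m * m + t)) = t) /\
      forall t i, RANK < t -> arr h t i = 0]) (fun h => m - var h vi) 3 _ m).
- move=> h4 [cm ci ca cr [ck cz]] /= d; apply: runs_run => //.
  have lt : var h4 vi < m by lia.
  split; last by rewrite /= /update /=; lia.
  split=> //; rewrite /= /update /= ?addn1 //; split=> [t|t i].
    rewrite ca ltnS leq_eqVlt => /orP[/eqP->|tl]; first by rewrite eqxx.
    by case: eqP => [E|_]; [apply/esym/inj; rewrite ?(ltn_trans tl) //|apply: ck].
  by case: t => [|[|t]] // _; apply: cz.
- split=> //; split=> // t i Ht; rewrite /h3 /=; apply: bz; exact: ltn_trans Ht.
- by rewrite leq_subr.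
- by [].
move=> h4 [[cm ci ca cr [ck cz]] d]; split=> // [i im|t tm].
  by rewrite cr br.
by apply: ck; move: d => /=; lia.
Qed.

Definition deg x := \sum_(j < m) inp (x * m + j).

Lemma find_root_ok h rank : var h vm = m -> (forall i, i < m -> arr h ROW i = i * m) ->
  arr h RANK = rank -> (forall t i, RANK < t -> arr h t i = 0) ->
  (exists2 x, x < m & deg x <= 1) ->
  runs inp find_root h (m * (m * 6 + 13) + 10) (fun h' => [/\ var h' vm = m,
    forall i, i < m -> arr h' ROW i = i * m, arr h' RANK = rank,
    forall t i, RANK < t -> arr h' t i = 0
    & var h' vroot < m /\ deg (var h' vroot) <= 1]).
Proof.
move=> hm hr hk hz [x0 x0m dx0].
pose base h := [/\ var h vm = m, forall i, i < m -> arr h ROW i = i * m,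
  arr h RANK = rank & forall t i, RANK < t -> arr h t i = 0].
pose I h := [/\ base h, var h vi <= m & forall x, x < var h vi -> deg x <= 1 ->
  var h vroot < m /\ deg (var h vroot) <= 1].
apply: (@runs_le _ _ _ (1 + (m * (m * 6 + 12).+1).+1)); last by lia.
apply: runs_seq_run => //.
apply: runs_weaken; first apply: (@runs_while _ _ _ I (fun h => m - var h vi)
  (m * 6 + 12) _ m).
- move=> h1 [[b1 b2 b3 b4] b5 b6] /= c; have lt : var h1 vi < m by lia.
  apply: (@runs_le _ _ _ (1 + (1 + ((m * 6).+1 + 9)))); last by lia.
  do 2 (apply: runs_seq_run => //).
  apply: runs_seq.
    apply: (@runs_while _ _ _ (fun h => [/\ base h, var h vi = var h1 vi,
      var h vroot = var h1 vroot, var h vj <= m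
      & var h vdeg = \sum_(j < var h vj) inp (var h1 vi * m + j)])
      (fun h => m - var h vj) 5).
    + move=> h2 [[d1 d2 d3 d4] d5 d6 d7 d8] /= d; apply: runs_run => //.
      have lt2 : var h2 vj < m by lia.
      split; last by rewrite /= /update /=; lia.
      split=> //; rewrite /= /update /= ?addn1 //.
      by rewrite big_ord_recr /= d8 d5 d2.
    + by split=> //; rewrite /= /update /= big_ord0.
    + by rewrite leq_subr.
  move=> h2 [[[d1 d2 d3 d4] d5 d6 d7 d8] d]; apply: runs_run => //.
  have jm : var h2 vj = m by move: d => /=; lia.
  rewrite jm -/(deg _) in d8; rewrite /= d8.
  case: ifP => [/eqP dg|/negbT dg]; (split; last by rewrite /= /update /= d5; lia);
    split=> //; rewrite /= /update /= ?d5 ?d6 addn1 // => x; rewrite ltnS leq_eqVlt.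
  + by move=> _ _; split=> //; lia.
  + by case/orP=> [/eqP->|]; [lia|apply: b6].
- by split.
- by rewrite leq_subr.
- by [].
move=> h1 [[[b1 b2 b3 b4] b5 b6] c]; split=> //.
by apply: (b6 x0) => //; move: c => /=; lia.
Qed.

Record numbering root (lab par skip : nat -> nat) : Prop := Numbering {
  num_par_lt : forall i, 0 < i -> par i < i;
  num_skip_gt : forall i, i < m -> i < skip i;
  num_skip_le : forall i, i < m -> skip i <= m;
  num_skipP : forall i j, i < j < m -> (j < skip i) = (i <= par j < skip i);
  num_lab : forall i, i < m -> lab i < m;
  num_inj : forall i j, i < m -> j < m -> lab i = lab j -> i = j;
  num_root : lab 0 = root;
  num_edge : forall i, 0 < i < m -> adj (lab (par i)) (lab i) }.

(** Connectivity as an induction principle, convenient for candidates given as natural numbers. *)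
Definition reachable root := forall P : nat -> Prop, P root ->
  (forall x y, x < m -> y < m -> P x -> adj x y -> P y) -> forall y, y < m -> P y.

(** At the end all scans are complete, so the visited candidates are closed under adjacency and
    hence are all candidates. *)
Lemma dfs_numbering root rank h : dfs_inv root rank h -> var h vrun = 0 ->
  reachable root -> numbering root (arr h LAB) (arr h PAR) (arr h SKIP).
Proof.
case=> i1 i2 i3 i4 i5 i6 i7 i8 i9 i10 i11 i12 i13 i14 i15 i16 run0 conn_root.
rewrite run0 /= in i16; set c := var h vcnt in i4 i5 i6 i7 i9 i10 i11 i12 i13 i14 i15 i16.
have all_vis y : y < m -> exists2 i, i < c & arr h LAB i = y.
  apply: (conn_root (fun y => exists2 i, i < c & arr h LAB i = y)).
    by exists 0 => //; apply: leq_ltn_trans i4.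
  move=> x z xm zm [i ic <-] ez; apply/i9.
  by have [s1 _ _] := i14 i ic (i16 i ic); have [_] := i12 i ic; apply; rewrite ?s1.
have cm : c = m.
  apply/eqP; rewrite eqn_leq i5 /= -(size_iota 0 m) -[c in _ <= c](size_iota 0 c).
  rewrite -(size_map (arr h LAB) (iota 0 c)); apply: uniq_leq_size; first exact: iota_uniq.
  move=> y; rewrite mem_iota add0n => /andP[_ /all_vis[i ic <-]].
  by apply: map_f; rewrite mem_iota.
rewrite cm in i6 i7 i10 i11 i12 i14 i16; split=> //.
- move=> i i0; case: (ltnP i m) => im; last by rewrite i11.
  by have [|] := i10 i; rewrite ?i0.
- by move=> i im; have [_ /andP[]] := i14 i im (i16 i im).
- by move=> i im; have [_ /andP[]] := i14 i im (i16 i im).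
- move=> i j /andP[ij jm]; have im := ltn_trans ij jm.
  by have [_ _ ->] := i14 i im (i16 i im); rewrite ?ij.
- by move=> i /i10[].
Qed.

Lemma dfs_ok h root rank : var h vm = m -> (forall i, i < m -> arr h ROW i = i * m) ->
  arr h RANK = rank -> (forall t i, RANK < t -> arr h t i = 0) ->
  var h vroot = root -> root < m -> reachable root ->
  runs inp dfs h (m * m.+1 * 40 + 20) (fun h' => [/\ var h' vm = m,
    arr h' RANK = rank & numbering root (arr h' LAB) (arr h' PAR) (arr h' SKIP)]).
Proof.
move=> hm hr hk hz hroot rm conn_root.
apply: (@runs_le _ _ _ (1 + (1 + (1 + (1 + (1 + (m * m.+1 * 40).+1)))))); last by lia.
do 5 (apply: runs_seq_run => //).
set h1 := (X in runs _ _ X).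
apply: runs_weaken; first apply: (@runs_while _ _ _ (dfs_inv root rank) dfs_left 39 _ (m * m.+1)).
- move=> h2 inv r0; apply: runs_run => //; exact: dfs_step_ok inv r0.
- have z t i : RANK < t -> LAB < t -> VIS < t -> arr h1 t i = 0.
    by case: t => [|[|[|[|t]]]] // _ _ _; apply: hz.
  split=> //; rewrite /h1 /= /update /= ?hroot //.
  + by move=> i; rewrite ltnS leqn0 => /eqP->.
  + by move=> i j; rewrite !ltnS !leqn0 => /eqP-> /eqP->.
  + move=> w; split=> [|[i]].
      by case: (w =P root) => [->|_]; [exists 0|rewrite hz].
    by rewrite ltnS leqn0 => /eqP-> /= ->; rewrite eqxx.
  + by case.
  + by move=> i _; apply: hz.
  + by move=> i _; rewrite hz.
  + by move=> i _; rewrite !hz.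
  + by move=> i _; rewrite hz.
  + move=> i; rewrite ltnS leqn0 => /eqP-> _; split=> // j /andP[]; lia.
  + exact: hz.
- apply: (@leq_trans (\sum_(i < m) m.+1)); last by rewrite sum_nat_const card_ord.
  by apply: leq_sum => i _; case: (_ == 0); lia.
- by [].
move=> h2 [inv run0]; split; [exact: dfs_m inv|exact: dfs_rank inv|].
exact: dfs_numbering inv run0 conn_root.
Qed.

Lemma weigh_ok h root rank lab par skip : var h vm = m -> arr h RANK = rank ->
  arr h LAB = lab -> arr h PAR = par -> arr h SKIP = skip ->
  numbering root lab par skip ->
  runs inp weigh h (m * 10 + 10) (fun h' =>
    static par (arr h' POS) m skip h' /\
    forall i, i < m -> arr h' POS i = rank (lab i)).
Proof.
move=> hm hk hl hp hs num.
apply: (@runs_le _ _ _ (1 + (1 + (m * 10).+1))); last by lia.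
do 2 (apply: runs_seq_run => //).
pose I h := [/\ var h vm = m, [/\ arr h RANK = rank, arr h LAB = lab, arr h PAR = par
   & arr h SKIP = skip], var h vi <= m, var h vwt = m.+1 * 2 ^ var h vi
  & forall i, i < var h vi -> arr h POS i = rank (lab i) /\ arr h WT i = weight m i].
apply: runs_weaken; first apply: (@runs_while _ _ _ I (fun h => m - var h vi) 9 _ m).
- move=> h1 [b1 [b2 b3 b4 b5] b6 b7 b8] /= d; apply: runs_run => //.
  have lt : var h1 vi < m by lia.
  split; last by rewrite /= /update /=; lia.
  split=> //; rewrite /= /update /= ?addn1 //.
    by rewrite b7 expnS mulnCA addnn mul2n.
  move=> i; rewrite ltnS leq_eqVlt; case: eqP => [->|_] /=; last exact: b8.
  by rewrite b2 b3 b7.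
- by split=> //; rewrite /= /update /= ?hm ?addn1 ?muln1.
- by rewrite leq_subr.
- by [].
move=> h1 [[b1 [b2 b3 b4 b5] b6 b7 b8] d].
have im : var h1 vi = m by move: d => /=; lia.
rewrite im in b7 b8; split=> [|i /b8[]//]; split=> // i /b8[]//.
Qed.

Theorem swap_prog_ok h rank k : var h vm = m -> var h vacc = 0 ->
  (forall t i, arr h t i = 0) ->
  (forall t, t < m -> inp (m * m + t) < m /\ rank (inp (m * m + t)) = t) ->
  (forall x, x < m -> exists2 t, t < m & inp (m * m + t) = x) ->
  (exists2 x, x < m & deg x <= 1) ->
  (forall root, root < m -> reachable root) ->
  (forall root lab par skip, deg root <= 1 -> numbering root lab par skip ->
     nleaves skip 0 m <= k) ->
  runs inp swap_prog h
    (12 * m + 10 + (m * (m * 6 + 13) + 10 + (m * m.+1 * 40 + 20 + (m * 10 + 10 +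
      (m * ((k * 12 + 174) * m ^ k + 102) + 3)))))
    (fun h' => exists root lab par skip pos,
       [/\ numbering root lab par skip, deg root <= 1,
       forall i, i < m -> pos i = rank (lab i)
     & is_opt par pos (full_set m) (var h' vm)]).
Proof.
move=> hm ha hz hrank hsurj hdeg hconn hleaves.
apply: runs_seq.
  apply: number_ok => // t t' tm tm' E.
  by have [_ <-] := hrank t tm; have [_ <-] := hrank t' tm'; rewrite E.
move=> h1 [m1 r1 k1 z1]; apply: runs_seq; first exact: find_root_ok m1 r1 erefl z1 hdeg.
move=> h2 [m2 r2 k2 z2 [rm dr]].
apply: runs_seq; first exact: dfs_ok m2 r2 k2 z2 erefl rm (hconn _ rm).
move=> h3 [m3 k3 num].
apply: runs_seq; first exact: weigh_ok m3 k3 erefl erefl erefl num.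
move=> h4 [st pos4]; have lk := hleaves _ _ _ _ dr num; have [n1 n2 n3 n4 _ _ _ _] := num.
apply: runs_weaken; first exact: (solve_all_ok n1 n2 n3 n4 inp m_gt0 st).
  rewrite leq_add2r leq_mul2l leq_add2r; apply/orP; right.
  apply: leq_mul; last by apply: leq_pexp2l.
  by rewrite /solve_time; lia.
move=> h5 opt; exists (var h2 vroot), (arr h3 LAB), (arr h3 PAR), (arr h3 SKIP), (arr h4 POS).
split=> // i im; rewrite pos4 //.
have [t tm <-] := hsurj _ (num_lab num im).
by rewrite k1 //; have [_ ->] := hrank t tm.
Qed.

End Numbering.

(** * Rankings as orders of positions *)

Section Ranking.

Variables (m : nat) (e : rel 'I_m) (v : ranking m).
Hypothesis tree : is_tree e.

Let inp := nth 0 (input_words e v).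

Lemma adjE (x y : 'I_m) : adj m inp x y = e x y.
Proof. by rewrite /adj /inp input_edge eqb0 negbK. Qed.

Lemma degE (x : 'I_m) : deg m inp x = degree e x.
Proof.
rewrite /deg /degree -sum1_card [RHS]big_mkcond; apply: eq_bigr => j _.
by rewrite inE /inp input_edge; case: (e x j).
Qed.

Lemma tree_reachable root : root < m -> reachable m inp root.
Proof.
move=> rm P Pr H y ym; apply: (tree_closed tree (A := P) (x := Ordinal rm) Pr _ (Ordinal ym)).
move=> a b Pa ab; apply: (H a b) => //; by rewrite adjE.
Qed.

Variables (root : nat) (lab par skip pos : nat -> nat).
Hypothesis num : numbering m inp root lab par skip.
Hypothesis posE : forall i (im : i < m), pos i = v (Ordinal (num_lab num im)).

Let par_lt := num_par_lt num.

Definition label_fun (i : 'I_m) : 'I_m := Ordinal (num_lab num (ltn_ord i)).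

Lemma label_inj : injective label_fun.
Proof. by move=> i j /(congr1 val) /= E; apply: val_inj; apply: (num_inj num) E. Qed.

Definition label : {perm 'I_m} := perm label_inj.

Lemma labelE (i : 'I_m) : label i = lab i :> nat.
Proof. by rewrite permE. Qed.

Lemma posE_label (i : 'I_m) : pos i = v (label i).
Proof.
by rewrite (posE (ltn_ord i)) permE; congr (nat_of_ord (v _)); apply: val_inj.
Qed.

Definition tree_edge (i j : 'I_m) := (0 < i) && (par i == j) || (0 < j) && (par j == i).

(** Parent edges are edges of the tree and connect every vertex to the root; by [spanning_edge]
    there are no others. *)
Lemma edgeE (i j : 'I_m) : e (label i) (label j) = tree_edge i j.
Proof.
have e_sym : symmetric e by case: tree => -[].
have sub (i' j' : 'I_m) : tree_edge i' j' -> e (label i') (label j').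
  have H (a b : 'I_m) : (0 < a) && (par a == b) -> e (label b) (label a).
    move=> /andP[a0 /eqP ab]; have aa : 0 < a < m by rewrite a0 /=.
    by have := num_edge num aa; rewrite ab -!labelE adjE.
  by case/orP=> /H //; rewrite e_sym.
apply/idP/idP; last exact: sub.
pose te := [rel a b | tree_edge ((label^-1)%g a) ((label^-1)%g b)].
have te_e : subrel te e.
  by move=> a b /= /sub; rewrite !permKV.
have te_sym : symmetric te by move=> a b; rewrite /= /tree_edge orbC.
have cte (i' j' : 'I_m) : connect te (label i') (label j').
  have H0 (a : 'I_m) : forall z : 'I_m, z = 0 :> nat -> connect te (label z) (label a).
    have [n] := ubnP a; elim: n a => // n IHn a an z z0.
    have [a0|a0] := posnP a; first by rewrite (_ : z = a) //; apply: val_inj; rewrite /= z0 a0.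
    have pa : par a < m by apply: ltn_trans (par_lt a0) _.
    apply: connect_trans (IHn (Ordinal pa) _ z z0) (connect1 _).
      by apply: leq_trans (par_lt a0) an.
    by rewrite /= !permK /tree_edge a0 eqxx orbT.
  have z := Ordinal (tree_gt0 tree).
  apply: connect_trans (H0 j' (Ordinal (tree_gt0 tree)) erefl).
  by rewrite (sym_connect_sym te_sym) H0.
by move/(spanning_edge tree te_e (cte i j)); rewrite /= !permK.
Qed.

Lemma conn_induced S (X : {set 'I_m}) : X != set0 -> {in S, forall i, i < m} ->
  (forall i : 'I_m, (val i \in S) = (label i \in X)) ->
  conn par S <-> induced_connected e X.
Proof.
move=> X0 Sm SX; rewrite /induced_connected X0 /=.
set r := [rel a b | _]; have e_sym : symmetric e by case: tree => -[].
have r_sym : symmetric r by move=> a b; rewrite /= e_sym andbCA.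
split=> [cS|/forall_inP H].
  have top (a : 'I_m) : label a \in X -> exists t : 'I_m,
      [/\ val t \in S, is_top par S t & connect r (label a) (label t)].
    have [n] := ubnP a; elim: n a => // n IHn a an aX.
    case ta : (is_top par S a).
      by exists a; split; rewrite ?SX ?connect0.
    move/negbT: ta; rewrite negb_or negbK => /andP[a0 pS].
    rewrite -lt0n in a0; have pa := Sm _ pS.
    have pX : label (Ordinal pa) \in X by rewrite -SX.
    have [|t [tS tt ct]] := IHn (Ordinal pa) _ pX.
      by apply: leq_trans (par_lt a0) an.
    exists t; split=> //; apply: connect_trans ct; apply: connect1.
    by rewrite /= aX pX edgeE /tree_edge a0 eqxx.
  apply/forall_inP=> x xX; apply/forall_inP=> y yX.
  rewrite -(permKV label x) -(permKV label y) in xX yX *.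
  have [t [tS tt ct]] := top _ xX; have [t' [tS' tt' ct']] := top _ yX.
  apply: connect_trans ct _; rewrite (sym_connect_sym r_sym).
  by rewrite (_ : t = t') //; apply: val_inj; apply: cS.
move=> x y xS yS tx ty; have xm := Sm _ xS; have ym := Sm _ yS.
pose d := [rel i j : 'I_m | [&& 0 < i, val i \in S, val j \in S & par i == j]].
(* For the converse, the candidates that climb to [x] by parent edges inside [S] form a set closed
   under adjacency in [X], so [y] climbs to [x]. Being a top, [y] cannot climb at all, so it is
   [x]. *)
have top_d (z b : 'I_m) : is_top par S z -> d z b -> False.
  move=> tz /and4P[z0 _ bS /eqP zb]; move: tz; rewrite /is_top zb bS orbF.
  by rewrite (gtn_eqF z0).
pose A (a : 'I_m) := connect d ((label^-1)%g a) (Ordinal xm).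
have Ax : A (label (Ordinal xm)) by rewrite /A permK.
have closed_A (a b : 'I_m) : A a -> r a b -> A b.
  rewrite /A -(permKV label a) -(permKV label b) !permK.
  move: ((label^-1)%g a) ((label^-1)%g b) => i j Ai /and3P[].
  rewrite -!SX edgeE => iS jS /orP[|] /andP[z0 /eqP ij].
    case/connectP: Ai => [[|i' q]] /=.
      move=> _ /(congr1 val) /= xi; rewrite xi in tx.
      by case: (top_d i j tx); rewrite /= z0 iS jS ij eqxx.
    case/andP=> /and4P[_ _ _ /eqP ii'] pq lq; apply/connectP; exists q => //.
      by rewrite (_ : j = i') //; apply: val_inj; rewrite /= -ij ii'.
    by rewrite (_ : j = i') //; apply: val_inj; rewrite /= -ij ii'.
  by apply: connect_trans Ai; apply: connect1; rewrite /= z0 jS iS ij eqxx.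
have lX : label (Ordinal xm) \in X by rewrite -SX.
have lY : label (Ordinal ym) \in X by rewrite -SX.
have : A (label (Ordinal ym)).
  have /forall_inP/(_ _ lY)/connectP[q] := H _ lX.
  elim: q (label _) Ax {lX} => [|z q IHq] w Aw /=; first by move=> _ ->.
  by case/andP=> wz; apply: IHq; apply: closed_A wz.
rewrite /A permK => /connectP[[|z q]] /=; first by move=> _ [->].
by case/andP=> /(top_d (Ordinal ym)) [].
Qed.

(** * Rankings as orders from the bottom to the top *)

Definition order_of (u : ranking m) : seq nat :=
  [seq val ((label^-1)%g ((u^-1)%g t)) | t <- rev (enum 'I_m)].

Lemma mem_drop_order u j (i : 'I_m) : j <= m ->
  (val i \in drop j (order_of u)) = (u (label i) < m - j).
Proof.
move=> jm; rewrite /order_of -map_drop drop_rev size_enum_ord.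
have inj : injective (fun t => val ((label^-1)%g ((u^-1)%g t))).
  by move=> a b /val_inj/perm_inj/perm_inj.
rewrite -[i in val i](permK label) -[label i in LHS](permK u) (mem_map inj).
by rewrite mem_rev in_take ?mem_enum // index_enum_ord.
Qed.

Lemma order_of_lt u i : i \in order_of u -> i < m.
Proof. by case/mapP=> t _ ->; apply: ltn_ord. Qed.

Lemma uniq_order u : uniq (order_of u).
Proof.
rewrite map_inj_uniq ?rev_uniq ?enum_uniq //.
by move=> a b /val_inj/perm_inj/perm_inj.
Qed.

Lemma perm_order u : perm_eq (order_of u) (full_set m).
Proof.
apply: uniq_perm; rewrite ?uniq_order ?rev_uniq ?iota_uniq // => i.
rewrite mem_rev mem_iota add0n /=; apply/idP/idP=> [|im]; first exact: order_of_lt.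
have := mem_drop_order u (Ordinal im) (leq0n m).
by rewrite drop0 subn0 ltn_ord.
Qed.

Lemma order_of_surj o : perm_eq o (full_set m) -> exists u, o = order_of u.
Proof.
move=> po; have so : size o = m by rewrite (perm_size po) size_rev size_iota.
have uo : uniq o by rewrite (perm_uniq po) rev_uniq iota_uniq.
have om i : i < m -> nth 0 o i < m.
  move=> im; have : nth 0 o i \in o by rewrite mem_nth ?so.
  by rewrite (perm_mem po) mem_rev mem_iota add0n => /andP[].
pose f (t : 'I_m) := label (Ordinal (om _ (ltn_ord (rev_ord t)))).
have fi : injective f.
  move=> a b /perm_inj[] /eqP; rewrite nth_uniq ?so ?(ltn_ord (rev_ord _)) // => /eqP E.
  by apply: rev_ord_inj; apply: val_inj.
(* [f] sends positions to candidates, a ranking candidates to positions; [rev_ord] reflects that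
   orders start at the bottom. *)
exists (perm fi)^-1%g; apply: (@eq_from_nth _ 0) => [|i].
  by rewrite size_map size_rev size_enum_ord.
rewrite so => im; rewrite (nth_map (Ordinal im)) ?size_rev ?size_enum_ord //.
rewrite nth_rev ?size_enum_ord // invgK (permE fi) /f (permK label) /=.
have lt : m - i.+1 < m by lia.
rewrite (_ : nth _ _ _ = Ordinal lt) /=; last first.
  by apply: val_inj; rewrite /= nth_enum_ord.
by congr (nth 0 o _); lia.
Qed.

Lemma valid_drop o : valid par o <-> forall j, j < size o -> conn par (drop j o).
Proof.
elim: o => [|x o IHo]; first by split.
split=> [[co /IHo vo] [|j] jo|H]; rewrite ?drop0 //=; first exact: vo.
by split; [exact: (H 0)|apply/IHo => j jo; exact: (H j.+1)].
Qed.

(** The nonempty suffixes of the order are the sets of top-ranked candidates. *)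
Lemma valid_order u : valid par (order_of u) <-> u \in SP e.
Proof.
have so : size (order_of u) = m by rewrite size_map size_rev size_enum_ord.
have H (t : 'I_m) : conn par (drop (m - t.+1) (order_of u)) <->
    induced_connected e (top_ranked u t.+1).
  apply: conn_induced.
  - by apply/set0Pn; exists ((u^-1)%g t); rewrite inE permKV.
  - by move=> i /mem_drop; apply: order_of_lt.
  - move=> i; rewrite mem_drop_order ?leq_subr // inE subKn //.
rewrite valid_drop so inE; split=> [V|/forallP V j jm].
  by apply/forallP=> t; apply/H; apply: V; have := ltn_ord t; lia.
have lt : m - j.+1 < m by lia.
have /H /= := V (Ordinal lt).
by rewrite (_ : m - (m - j.+1).+1 = j) //; lia.
Qed.

Lemma cost_map (T : eqType) (g : T -> nat) (h : T -> nat) s :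
  sorted (fun a b => h b < h a) s ->
  cost pos (map g s) =
    \sum_(t <- s) count (fun t' => (h t' < h t) && (pos (g t) < pos (g t'))) s.
Proof.
have tr : transitive (fun a b => h b < h a) by move=> y x z /= xy yz; apply: ltn_trans yz xy.
elim: s => [|t s IHs] /= pts; first by rewrite big_nil.
have /allP lt := order_path_min tr pts.
rewrite big_cons /= ltnn /= add0n IHs ?(path_sorted pts) //; congr (_ + _).
  rewrite /above count_map; apply: eq_in_count => t' /lt /= ->; by [].
rewrite big_seq [RHS]big_seq; apply: eq_bigr => t' /lt /= t't.
by rewrite ltnNge (ltnW t't).
Qed.

Lemma cost_order u : cost pos (order_of u) = swap u v.
Proof.
rewrite /order_of; set g := fun t => _.
rewrite (@cost_map _ g val); last first.
  rewrite rev_sorted; have := iota_ltn_sorted 0 m.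
  by rewrite -val_enum_ord sorted_map.
rewrite (perm_big (enum 'I_m)) ?perm_rev //= big_enum /=.
(* The cost counts ordered pairs with [a] below [b] in [u] but above it in [v]; each unordered pair
   of disagreement occurs in exactly one of its two orientations. *)
pose X (a b : 'I_m) := (u b < u a) && (v a < v b).
have -> : \sum_(t : 'I_m) count (fun t' => (val t' < val t) && (pos (g t) < pos (g t')))
    (rev (enum 'I_m)) = \sum_a \sum_b X a b.
  rewrite (reindex_inj (@perm_inj _ u)); apply: eq_bigr => a _.
  rewrite count_rev -sum1_count big_mkcond /= big_enum /= (reindex_inj (@perm_inj _ u)) /=.
  apply: eq_bigr => b _; rewrite /g !posE_label !permKV !permK.
  by rewrite /X; case: (_ && _).
have -> : swap u v = \sum_(a : 'I_m) \sum_(b : 'I_m) ((a < b) * X a b + (a < b) * X b a).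
  rewrite /swap -sum1_card big_mkcond /= pair_big /=; apply: eq_bigr => -[a b] _ /=.
  rewrite inE /prefers /X /=; case: (ltnP a b) => //= ab.
  have ne : a != b by rewrite -val_eqE neq_ltn ab.
  have une : u a != u b by rewrite (inj_eq perm_inj).
  have vne : v a != v b by rewrite (inj_eq perm_inj).
  rewrite -!val_eqE /= in une vne.
  by case: (ltngtP (u a) (u b)) une => //= _ _; case: (ltngtP (v a) (v b)) vne.
under [RHS]eq_bigr => a _ do rewrite big_split /=.
rewrite big_split /= [X in _ = _ + X]exchange_big -big_split /=.
apply: eq_bigr => a _; rewrite -big_split /=; apply: eq_bigr => b _.
case: (ltngtP a b) => [_|_|/val_inj->]; rewrite ?mul0n ?mul1n ?addn0 //.
by rewrite /X ltnn.
Qed.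

Lemma is_opt_swap_set d : is_opt par pos (full_set m) d -> is_swap_set (SP e) v d.
Proof.
case=> -[o [po vo <-]] H; split=> [|u uSP].
  have [u E] := order_of_surj po; exists u; last by rewrite E cost_order.
  by apply/valid_order; rewrite -E.
by rewrite -cost_order; apply: H; [exact: perm_order|apply/valid_order].
Qed.

(** * Leaves of the rooted tree and of the graph *)

Lemma nleaves_le : nleaves skip 0 m <= m.
Proof. by rewrite /nleaves (leq_trans (count_size _ _)) // size_iota subn0. Qed.

(** A childless vertex other than the root has its parent as only neighbour. The root has degree 1
    too and is not childless, which makes the inequality strict. *)
Lemma nleaves_lt : 1 < m -> deg m inp root <= 1 -> nleaves skip 0 m < num_leaves e.
Proof.
move=> m1 dr; pose B := [set i : 'I_m | skip i == i.+1].
have z0 : 0 < m := ltnW m1; pose z := Ordinal z0.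
have lz : label z = root :> nat by rewrite labelE (num_root num).
have skip0 : skip 0 != 1.
  have := num_skipP num (i := 0) (j := 1); rewrite m1 => /(_ isT).
  have p1 : par 1 = 0 by have := @par_lt 1; lia.
  have := num_skip_gt num z0; rewrite p1 /= => s0 E.
  by rewrite s0 in E; lia.
have -> : nleaves skip 0 m = #|B|.
  rewrite /nleaves subn0 -val_enum_ord count_map -sum1_count big_mkcond big_enum /=.
  by rewrite -sum1_card [RHS]big_mkcond; apply: eq_bigr => i _; rewrite inE.
have zB : label z \notin [set label i | i in B].
  by apply/imsetP=> -[i iB /perm_inj E]; rewrite -E inE (negPf skip0) in iB.
rewrite /num_leaves -(card_imset (mem B) (@perm_inj _ label)).
have := cardsU1 (label z) [set label i | i in B]; rewrite zB add1n => <-.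
apply: subset_leq_card; apply/subsetP=> x; rewrite !inE => /orP[/eqP->|/imsetP[i iB ->]].
  rewrite eqn_leq -degE lz dr /= -lz degE /degree card_gt0; apply/set0Pn.
  exists (label (Ordinal m1)); rewrite inE edgeE /tree_edge /=.
  by have := @par_lt 1 isT; rewrite ltnS leqn0.
rewrite inE in iB; have i0 : 0 < i.
  by rewrite lt0n; apply: contraNneq skip0 => E; move: iB; rewrite E.
have pm : par i < m := ltn_trans (par_lt i0) (ltn_ord i).
rewrite /degree (_ : [set y | _] = [set label (Ordinal pm)]) ?cards1 //.
apply/setP=> y; rewrite !inE -(permKV label y) edgeE (inj_eq perm_inj).
move: ((label^-1)%g y) => j; rewrite /tree_edge i0 /= -val_eqE /= eq_sym.
case: eqP => //= _; apply/negP=> /andP[j0 /eqP pj].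
have ij : i < j by rewrite -pj par_lt.
have := num_skipP num (i := i) (j := j); rewrite ij ltn_ord => /(_ isT).
by rewrite (eqP iB) pj leqnn ltnSn ltnS leqNgt ij.
Qed.

End Ranking.

(** * The final time bound *)

(** Everything outside the enumeration is quadratic in [m] and is absorbed because [k] is at least
    2; the enumeration contributes at most 186 = 12 + 174 times the target. *)
Lemma swap_prog_time m k : 1 < m -> 1 < k ->
  12 * m + 10 + (m * (m * 6 + 13) + 10 + (m * m.+1 * 40 + 20 + (m * 10 + 10 +
    (m * ((k.-1 * 12 + 174) * m ^ k.-1 + 102) + 3)))) <= 1000 * (k * m ^ k).
Proof.
case: k => [|k] //= m1 k0; set M := k.+1 * m ^ k.+1.
have mk : m * m ^ k = m ^ k.+1 by rewrite expnS.
have mM : m * m <= M.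
  rewrite /M mulnn; apply: leq_trans (leq_pmull _ _) => //; exact: leq_pexp2l (ltnW m1) _.
have mm : m + m <= m * m by rewrite addnn -mul2n leq_mul2r m1 orbT.
have kM : m * ((k * 12 + 174) * m ^ k) <= 186 * M.
  rewrite mulnCA mk /M mulnA leq_mul2r; apply/orP; right; lia.
move: kM; set A := m * (_ * _) => kM; rewrite [m * (_ + 102)]mulnDr -/A; clearbody M A.
rewrite [m * (m * 6 + _)]mulnDr mulnA [m * m.+1]mulnS; lia.
Qed.

Theorem theorem4p5 :
  exists (P : cmd) (c : nat),
    forall (m k : nat) (T : rel 'I_m) (v : ranking m),
      is_tree T -> num_leaves T = k ->
      exists (t : nat) (s : state),
        [/\ exec P (input T v) t s,
            is_swap_set (SP T) v (output s)
          & 1 < m -> t <= c * (k * m ^ k)].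
Proof.
(* The prologue takes at most [3 * m + 5 <= 8 * m] steps, whence the 8. *)
exists (Defs.Seq prologue (comp swap_prog)), (8 + slowdown swap_prog * 1000).
move=> m k T v tree kT; have m0 := tree_gt0 tree.
set inp := nth 0 (input_words T v).
pose rank x := if insub x is Some a then nat_of_ord (v a) else 0.
have rankE (a : 'I_m) : rank a = v a by rewrite /rank valK.
have [t1 [s1 [x1 le1 rep1]]] := exec_prologue T v.
have [x dx] := tree_leaf tree.
(* A single vertex has degree 0, so [k = 0] there, but the rooted tree still has one childless
   vertex; [m] serves as the bound then. *)
pose K := if m == 1 then m else k.-1.
have [] := @swap_prog_ok m inp m0 (Env (update (fun=> 0) 0 m) (fun _ _ => 0)) rank K.
- by [].
- by [].
- by [].
- move=> t tm; rewrite /inp (input_rank T v (Ordinal tm)); split; first exact: ltn_ord.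
  by rewrite rankE permKV.
- move=> y ym; exists (v (Ordinal ym)); first exact: ltn_ord.
  by rewrite /inp input_rank permK.
- by exists x; rewrite // degE.
- exact: tree_reachable.
- move=> root lab par skip dr num; rewrite /K; case: eqP => m1.
    exact: nleaves_le.
  have m1' : 1 < m by lia.
  by rewrite -ltnS (ltn_predK (_ : 0 < k)) -?kT; have := nleaves_lt tree num m1' dr; lia.
move=> t2 [h' [x2 le2 [root [lab [par [skip [pos [num dr posE opt]]]]]]]].
have inp0 i : m * m + m <= i -> inp i = 0.
  by move=> im; rewrite /inp nth_default // size_cat size_allpairs size_map size_enum_ord.
have wfp : wf swap_prog by [].
have [t3 [s3 [x3 le3 rep3]]] := exec_comp inp0 x2 wfp rep1.
exists (t1 + t3), s3; split.
- exact: exec_seq x1 x3.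
- have [out _ _ _] := rep3; rewrite /output (out 0).
  apply: (is_opt_swap_set tree (num := num)) opt => i im.
  by rewrite posE // -rankE.
(* The rooted tree has a childless vertex, and the root adds another leaf. *)
move=> m1; have k1 : 1 < k.
  have [n1 n2 n3 n4 _ _ _ _] := num; have := nleaves_lt tree num m1 dr.
  rewrite kT (@nleaves_add skip 0 (skip 0) m) ?n3 //=.
  by have := nleaves_gt0 n1 n2 n3 n4 m0; lia.
rewrite /K (gtn_eqF m1) in le2; have le4 := leq_trans le2 (swap_prog_time m1 k1).
move: (slowdown swap_prog) le3 => c le3.
have le5 : c * t2 <= c * (1000 * (k * m ^ k)) by rewrite leq_mul2l le4 orbT.
have le6 : m <= k * m ^ k.
  apply: leq_trans (leq_pmull _ (ltnW k1)).
  by rewrite -{1}(expn1 m) leq_pexp2l // ltnW.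
rewrite mulnDl -mulnA; lia.
Qed.
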